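(* Let $G_1$ be a graph, let $J$ be a (finite or infinite) index set, and for each $j\in J$ let $B_j:=B_{G_1}(w_j,K_j)$ be the ball with center $w_j\in V(G_1)$ and radius $K_j\in\mathbb{Z}^+$, such that $\sup_{j}K_j=K<\infty$, $\overline{B}_{j_1}\cap\overline{B}_{j_2}=\emptyset$ whenever $j_1\ne j_2$, and every odd cycle $C$ in $G_1$ satisfies $C\cap B_j\neq\emptyset$ for some $j\in J$. Suppose that $\{B_j\}_{j\in J}$ is $M$-regular for some $M>0$. Let $G_2$ be a non-trivial bounded graph without odd cycles. Then the following statements are equivalent: (1) $G_1\times G_2$ is hyperbolic. (2) $G_1$ is hyperbolic and there exists a constant $c_1$ such that for every $k,l\in J$ there exists a geodesic $[w_kw_l]$ in $G_1$ joining the centers $w_k$ and $w_l$ with $d_{G_1}\big(x,\bigcup_{j\in J}\{w_j\}\big)\le c_1$ for every $x\in[w_kw_l]$. (3) $G_1$ is hyperbolic and there exist constants $c_2,\alpha,\beta$ such that for every $k,l\in J$ we have $d_{G_1}\big(x,\bigcup_{j\in J}\{w_j\}\big)\le c_2$ for every $x$ in some $(\alpha,\beta)$-quasi-geodesic joining $w_k$ with $w_l$ in $G_1$.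
   Context: Conventions. A graph $G$ (such as $G_1,G_2$) is a nonempty, connected, simple (no loops, no multiple edges), possibly infinite graph; every edge has length $1$, and $G$ is regarded as a geodesic metric space by identifying each edge isometrically with $[0,1]$ and using the shortest-path distance $d_G$ (so points of $G$ are vertices and interior points of edges). A graph is trivial if it has exactly one vertex, and bounded if it has finite diameter. A cycle is a simple closed curve (a closed path with no repeated vertices except first = last); it is odd if its length is odd. $L$ denotes length. $B_G(w,r)=\{x\in G: d_G(x,w)<r\}$ is the open ball and $\overline{B}$ is the closure of $B$ in $G$. $M$-regularity: a family $\{B_j\}_{j\in J}$ of balls as in the statement is $M$-regular if for every $j\in J$ there is an odd cycle $C_j$ in $G_1$ with $C_j\cap B_j\ne\emptyset$ and $L(C_j)<M$. Quasi-geodesic: for $\alpha\ge1$, $\beta\ge0$, a map $f:X\to Y$ between metric spaces is an $(\alpha,\beta)$-quasi-isometric embedding if $\alpha^{-1}d_X(x,y)-\beta\le d_Y(f(x),f(y))\le\alpha d_X(x,y)+\beta$ for all $x,y\in X$. An $(\alpha,\beta)$-quasi-geodesic in $X$ is an $(\alpha,\beta)$-quasi-isometric embedding of an interval of $\mathbb{R}$ into $X$. Direct product: $G_1\times G_2$ has vertex set $V(G_1)\times V(G_2)$, and $(u_1,v_1)$, $(u_2,v_2)$ are adjacent iff $[u_1,u_2]\in E(G_1)$ and $[v_1,v_2]\in E(G_2)$. It may be disconnected. Hyperbolicity: in a geodesic metric space $X$, a geodesic triangle is the union of three geodesics $[x_1x_2],[x_2x_3],[x_3x_1]$; it is $\delta$-thin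 if each side is contained in the $\delta$-neighborhood of the union of the other two sides. $\delta(T)$ is the infimum of $\delta\ge 0$ such that $T$ is $\delta$-thin, $\delta(X):=\sup_T\delta(T)$ over all geodesic triangles $T$ in $X$, and $X$ is hyperbolic if $\delta(X)<\infty$. If $X$ has connected components $X_i$, then $\delta(X):=\sup_i\delta(X_i)$, and $X$ is hyperbolic if $\delta(X)<\infty$. *)

(* Defs.v *)
From HB Require Import structures.
From mathcomp Require Import all_boot all_order all_algebra.
From mathcomp Require Import all_classical all_reals all_analysis.

Set Implicit Arguments.
Unset Strict Implicit.
Unset Printing Implicit Defensive.

Import Order.TTheory GRing.Theory Num.Theory.
Import numFieldNormedType.Exports.

Local Open Scope classical_set_scope.
Local Open Scope ring_scope.

(* Possibly infinite and possibly disconnected; classically, neither the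
   [eqType] structure nor the boolean [adj] is a restriction. *)
Record sgraph := SGraph {
  vert :> eqType;
  adj : rel vert;
  adj_sym : symmetric adj;
  adj_irr : irreflexive adj }.
Arguments adj {s}.

Definition connected_graph (G : sgraph) : Prop :=
  inhabited G /\
  forall u v : G, exists2 p : seq G, path adj u p & last u p = v.

Definition trivial_graph (G : sgraph) : Prop := exists v : G, forall u : G, u = v.

(* The length of the cycle is [size s]; the closing edge joins the last vertex
   of [s] to the first, which is not repeated in [s]. *)
Definition is_cycle (G : sgraph) (s : seq G) : Prop :=
  (2 < size s)%N /\ ucycle adj s.

Definition odd_cycle (G : sgraph) (s : seq G) : Prop :=
  is_cycle s /\ odd (size s).

Section DirectProduct.
Variables G1 G2 : sgraph.

Definition dprod_adj : rel (G1 * G2)%type :=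
  fun p q => adj p.1 q.1 && adj p.2 q.2.

Lemma dprod_adj_sym : symmetric dprod_adj.
Proof. by move=> p q; rewrite /dprod_adj adj_sym (adj_sym p.2). Qed.

Lemma dprod_adj_irr : irreflexive dprod_adj.
Proof. by move=> p; rewrite /dprod_adj adj_irr. Qed.

Definition dprod : sgraph := SGraph dprod_adj_sym dprod_adj_irr.

End DirectProduct.

(* A point of the geometric realization is given by its barycentric
   coordinates: [bary_edge u v t] is the point of the edge [u, v] whose
   distance to [u] along the edge is [t]. *)
Section Realization.
Variables (R : realType) (G : sgraph).

Definition bary_vertex (v : G) : G -> R := fun w => (w == v)%:R.

Definition bary_edge (u v : G) (t : R) : G -> R :=
  fun w => (1 - t) * bary_vertex u w + t * bary_vertex v w.

Definition is_bary (x : G -> R) : Prop :=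
  (exists v, x = bary_vertex v) \/
  (exists u v t, [/\ adj u v, 0 <= t <= 1 & x = bary_edge u v t]).

Record gpoint := GPoint { bary :> G -> R; baryP : is_bary bary }.

Lemma is_bary_vertex v : is_bary (bary_vertex v).
Proof. by left; exists v. Qed.

Definition vpoint (v : G) : gpoint := GPoint (is_bary_vertex v).

Definition edge_points (u v : G) : set gpoint :=
  [set x | exists2 t, 0 <= t <= 1 & bary x = bary_edge u v t].

Definition cycle_points (s : seq G) : set gpoint :=
  [set x | exists2 u, u \in s & edge_points u (next s u) x].

(* [bpath x y l]: some path of length [l] goes from [x] to [y] and is a
   concatenation of finitely many segments, each contained in an edge. *)
Inductive bpath (x : gpoint) : gpoint -> R -> Prop :=
| bpath_nil : bpath x x 0
| bpath_rcons (y z : gpoint) (l : R) (u v : G) (s t : R) :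
    bpath x y l -> adj u v -> 0 <= s <= 1 -> 0 <= t <= 1 ->
    bary y = bary_edge u v s -> bary z = bary_edge u v t ->
    bpath x z (l + `|s - t|).

(* [+oo] on points of distinct connected components *)
Definition gdist (x y : gpoint) : \bar R :=
  ereal_inf [set l%:E | l in bpath x y].

Lemma bpath_ge0 x y l : bpath x y l -> 0 <= l.
Proof. by elim=> // *; rewrite addr_ge0. Qed.

Lemma bpath_cat x y z l m : bpath x y l -> bpath y z m -> bpath x z (l + m).
Proof.
move=> xy; elim=> [|y' z' m' u v s t _ IH uv s01 t01 ys zt].
  by rewrite addr0.
by rewrite addrA; exact: bpath_rcons IH uv s01 t01 ys zt.
Qed.

Lemma bpath_sym x y l : bpath x y l -> bpath y x l.
Proof.
elim=> [|y' z m u v s t _ IH uv s01 t01 ys zt]; first exact: bpath_nil.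
rewrite addrC; apply: bpath_cat IH; rewrite distrC -[X in bpath _ _ X]add0r.
exact: bpath_rcons (bpath_nil z) uv t01 s01 zt ys.
Qed.

Definition gball (x : gpoint) (r : R) : set gpoint :=
  [set y | (gdist x y < r%:E)%E].

Lemma gballP x r y : gball x r y <-> exists2 l, bpath x y l & l < r.
Proof.
split=> [/ereal_inf_lt[_ [l xl <-]]|[l xl lr]].
  by rewrite lte_fin => lr; exists l.
apply: le_lt_trans (_ : (l%:E < r%:E)%E); last by rewrite lte_fin.
by apply: ereal_inf_lbound; exists l.
Qed.

Lemma gball_center x (e : R) : 0 < e -> gball x e x.
Proof. by move=> e0; apply/gballP; exists 0 => //; exact: bpath_nil. Qed.

Lemma gball_sym x y (e : R) : gball x e y -> gball y e x.
Proof.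
by move=> /gballP[l xy le]; apply/gballP; exists l => //; exact: bpath_sym.
Qed.

Lemma gball_triangle x y z (e1 e2 : R) :
  gball x e1 y -> gball y e2 z -> gball x (e1 + e2) z.
Proof.
move=> /gballP[l xy le] /gballP[m yz me]; apply/gballP.
by exists (l + m); [exact: bpath_cat xy yz|rewrite ltrD].
Qed.

Definition gent : set_system (gpoint * gpoint) := entourage_ gball.

HB.instance Definition _ := gen_eqMixin gpoint.
HB.instance Definition _ := gen_choiceMixin gpoint.
HB.instance Definition _ := hasNbhs.Build gpoint (nbhs_ gent).
HB.instance Definition _ := @Nbhs_isPseudoMetric.Build R gpoint
  gent erefl gball gball_center gball_sym gball_triangle erefl.

Lemma edist_gdist (x y : gpoint) : edist (x, y) = gdist x y.
Proof.
apply/eqP; rewrite eq_le; apply/andP; split.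
- apply: le_ereal_inf_tmp => _ [l xy <-]; apply/lee_addgt0Pr => e e0.
  rewrite -EFinD; apply: edist_fin.
    by rewrite ltr_wpDl// (bpath_ge0 xy).
  by apply/gballP; exists l => //; rewrite ltrDl.
- by apply: le_ereal_inf_tmp => _ [r [_ xy] <-]; exact/ltW.
Qed.

End Realization.

Arguments vpoint R {G} v.
Arguments cycle_points R {G} s.

(* Distances are taken in [\bar R] by means of [edist], as the realization of a
   direct product may be disconnected. *)
Section Metric.
Variables (R : realType) (X : pseudoMetricType R).
Implicit Types (x y : X) (A S : set X).

Definition bounded_space : Prop :=
  (ereal_sup [set edist xy | xy in @setT (X * X)] < +oo)%E.

(* [S] is (the image of) a geodesic joining [x] to [y] *)
Definition geodesic x y S : Prop :=
  exists (L : R) (g : R -> X),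
    [/\ 0 <= L, g 0 = x, g L = y,
        {in `[0, L] &, forall s t, edist (g s, g t) = `|s - t|%:E} &
        S = g @` `[0, L]].

(* Taking the closed neighborhood does not affect [delta_triangle]. *)
Definition neighborhood (d : R) A : set X :=
  [set x | (edist_inf A x <= d%:E)%E].

Definition thin (d : R) S1 S2 S3 : Prop :=
  [/\ S1 `<=` neighborhood d (S2 `|` S3),
      S2 `<=` neighborhood d (S3 `|` S1) &
      S3 `<=` neighborhood d (S1 `|` S2)].

Definition delta_triangle S1 S2 S3 : \bar R :=
  ereal_inf [set d%:E | d in [set d | 0 <= d /\ thin d S1 S2 S3]].

Definition geodesic_triangle S1 S2 S3 : Prop :=
  exists x1 x2 x3,
    [/\ geodesic x1 x2 S1, geodesic x2 x3 S2 & geodesic x3 x1 S3].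

Definition component x : set X := [set y | (edist (x, y) < +oo)%E].

Definition delta_component x : \bar R :=
  ereal_sup [set e | exists S1 S2 S3,
    [/\ geodesic_triangle S1 S2 S3, S1 `|` S2 `|` S3 `<=` component x &
        e = delta_triangle S1 S2 S3]].

Definition hyperbolicity_constant : \bar R :=
  ereal_sup [set delta_component x | x in setT].

Definition hyperbolic : Prop := (hyperbolicity_constant < +oo)%E.

(* [f], restricted to [a, b], is an (alpha, beta)-quasi-geodesic joining [x]
   to [y]; [f] need not be continuous. *)
Definition quasi_geodesic (alpha beta : R) x y (a b : R) (f : R -> X) : Prop :=
  [/\ a <= b, f a = x, f b = y &
      {in `[a, b] &, forall s t,
        ((alpha^-1 * `|s - t| - beta)%:E <= edist (f s, f t))%E /\
        (edist (f s, f t) <= (alpha * `|s - t| + beta)%:E)%E}].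

End Metric.

Arguments bounded_space {R} X.
Arguments hyperbolicity_constant {R} X.
Arguments hyperbolic {R} X.

(* Main.v *)
(** Color properly the part of [G1] lying outside the balls, which has no odd
    cycle, and color the bipartite graph [G2]; the sum of both colors splits the
    vertices of [G1 x G2] into two sheets. A walk that changes sheet must visit
    a ball, and conversely the odd cycles near the [w j] allow one to change
    sheet there at bounded cost. Hence, up to additive constants, the distance
    of [(u, a)] and [(v, b)] is [d u v] on the same sheet, and
    [min_j d u (w j) + d (w j) v] on different ones. Additive errors are harmless
    in Gromov's four-point condition, so that everything can be done with the
    four-point condition on vertices.
    If the product is hyperbolic, the condition for the two lifts of [x] and one
    lift of [w j] and [w k] says that twice the distance from [x] to the [w l] is
    at most [d x (w j) + d x (w k) - d (w j) (w k)], up to a constant, which is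
    the quasi-convexity of the set of centers. Conversely, quasi-convexity makes
    the shortest sheet-changing route from [u] to [v] pass through the
    projection of [v], up to a constant, and the four-point condition for the
    product follows from the one for [G1].
    That (3) implies quasi-convexity is the half of the Morse lemma which says
    that a geodesic remains close to a quasi-geodesic with the same ends. *)

Require Import Defs.
From HB Require Import structures.
From mathcomp Require Import all_boot all_order all_algebra.
From mathcomp Require Import all_classical all_reals all_analysis.
From mathcomp Require Import ring lra zify.

Set Implicit Arguments.
Unset Strict Implicit.
Unset Printing Implicit Defensive.

Import Order.TTheory GRing.Theory Num.Theory.
Import numFieldNormedType.Exports.

Local Open Scope classical_set_scope.
Local Open Scope ring_scope.

(** * The four-point condition on two copies of a space, glued along a family *)

(** Gromov's condition, the maximum of two sums being written as a disjunction. The relation [E]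
    restricts it to points of one connected component, outside of which [d] may only take a default
    value. *)
Definition four_point (R : realType) (T : Type) (E : T -> T -> Prop)
    (d : T -> T -> R) (delta : R) : Prop :=
  forall x y z t, E x y -> E x z -> E x t ->
    d x y + d z t <= d x z + d y t + delta \/
    d x y + d z t <= d x t + d y z + delta.

(* In a hyperbolic space, this says that the geodesics joining points of the
   family [w] remain at a bounded distance from [w]: half of the right-hand side
   minus [d (w j) (w k)] is a Gromov product, that is, up to a constant, the
   distance from [x] to a geodesic joining [w j] to [w k]. *)
Definition quasi_convex (R : realType) (V J : Type) (d : V -> V -> R)
    (w : J -> V) (c : R) : Prop :=
  forall x j k, exists l,
    2 * d x (w l) + d (w j) (w k) <= d x (w j) + d x (w k) + c.

Record pmetric (R : realType) (T : Type) (d : T -> T -> R) : Prop := PMetric {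
  pm0 : forall x, d x x = 0;
  pmC : forall x y, d x y = d y x;
  pmD : forall x y z, d x z <= d x y + d y z }.

Section Doubling.
Variables (R : realType) (V J P : Type) (d : V -> V -> R) (w : J -> V).
Variables (E : P -> P -> Prop) (pr : P -> V) (s : P -> bool) (dh : P -> P -> R).
Variable C : R.
Hypothesis dm : pmetric d.
Hypothesis EC : forall X Y, E X Y -> E Y X.
Hypothesis ED : forall X Y Z, E X Y -> E Y Z -> E X Z.
Hypothesis dhC : forall X Y, dh X Y = dh Y X.
Hypothesis same_sheet : forall X Y, E X Y -> s X = s Y ->
  d (pr X) (pr Y) <= dh X Y + C /\ dh X Y <= d (pr X) (pr Y) + C.
Hypothesis cross_ub : forall X Y j, E X Y -> s X <> s Y ->
  dh X Y <= d (pr X) (w j) + d (w j) (pr Y) + C.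
Hypothesis cross_lb : forall X Y, E X Y -> s X <> s Y ->
  exists j, d (pr X) (w j) + d (w j) (pr Y) <= dh X Y + C.

(** Joining a lift of [x] to a lift of [w j] on the other sheet costs at most [d x (w j) + C], since
    the sheet can be changed at [w j] itself. Four distances are compared, whence [4 * C]. *)
Lemma quasi_convex_double (delta : R) :
  four_point E dh delta ->
  (forall x j k, exists X0 X1 Yj Yk,
     [/\ pr X0 = x, pr X1 = x, pr Yj = w j & pr Yk = w k] /\
     [/\ E X0 X1, E X0 Yj, E X0 Yk & [/\ s X0 <> s X1, s Yj = s X0 & s Yk = s X0]]) ->
  quasi_convex d w (delta + 4 * C).
Proof.
move=> fp Hex x j k.
have [X0 [X1 [Yj [Yk [[p0 p1 pj pk] [E01 E0j E0k [s01 sj sk]]]]]]] := Hex x j k.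
have [l hl] := cross_lb E01 s01.
have := same_sheet (ED (EC E0j) E0k) (etrans sj (esym sk)).
have := same_sheet E0j (esym sj).
have := same_sheet E0k (esym sk).
have s1j : s X1 <> s Yj by rewrite sj => /esym.
have s1k : s X1 <> s Yk by rewrite sk => /esym.
have := cross_ub j (ED (EC E01) E0j) s1j.
have := cross_ub k (ED (EC E01) E0k) s1k.
have := fp _ _ _ _ E01 E0j E0k.
rewrite p0 p1 pj pk in hl *; rewrite !(pm0 dm) (pmC dm (w l)) in hl *.
by move=> fpt h1 h2 [h3 h4] [h5 h6] [h7 h8]; exists l; case: fpt => ?; lra.
Qed.

Section FourPoint.
Variables (delta c : R).
Hypothesis fp : four_point (fun _ _ => True) d delta.
Hypothesis qc : quasi_convex d w c.
Hypothesis proj_ex : inhabited J ->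
  forall u, exists j, forall k, d u (w j) <= d u (w k).

Let near u p := forall k, d u (w p) <= d u (w k).

(** Quasi-convexity gives a center [w l] for the pair [w p], [w j], and [w p] is at least as close
    to [u] as [w l]. Thus a geodesic from [u] to any center nearly passes through the nearest
    one. *)
Lemma near_gap u p j : near u p -> d u (w p) + d (w p) (w j) <= d u (w j) + c.
Proof.
move=> np; have [l hl] := qc u p j; have := np l; lra.
Qed.

(** By [near_gap], a route through an arbitrary center can be diverted through the center nearest to
    [pr Y] at the cost [c]. *)
Lemma cross_sheet X Y p : E X Y -> s X <> s Y -> near (pr Y) p ->
  d (pr X) (w p) + d (w p) (pr Y) <= dh X Y + (C + c) /\
  dh X Y <= d (pr X) (w p) + d (w p) (pr Y) + C.
Proof.
move=> XY sXY np; split; last exact: cross_ub.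
have [j hj] := cross_lb XY sXY; have := near_gap j np.
have := pmD dm (pr X) (w j) (w p); rewrite !(pmC dm (pr Y)) (pmC dm (w j) (w p)).
lra.
Qed.

Lemma cross_near X Y : E X Y -> s X <> s Y -> exists p, near (pr Y) p.
Proof.
by move=> XY sXY; have [j _] := cross_lb XY sXY; exact: proj_ex (inhabits j) _.
Qed.

(** The symmetries below preserve the splitting of the four points into [x, y] and [z, t]. They
    leave four cases, named after the number of points on each sheet; in [fpt22a] the two splittings
    agree, in [fpt22b] they do not. *)
Let fpt D x y z t := dh x y + dh z t <= dh x z + dh y t + D \/
    dh x y + dh z t <= dh x t + dh y z + D.

Let fptW D D' x y z t : fpt D x y z t -> D <= D' -> fpt D' x y z t.
Proof. by case=> ? ?; [left|right]; lra. Qed.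

Let fpt_sym1 D x y z t : fpt D x y z t -> fpt D y x z t.
Proof. by rewrite /fpt (dhC y x) (dhC x t) (dhC x z); case=> ?; [right|left]; lra. Qed.

Let fpt_sym2 D x y z t : fpt D x y z t -> fpt D x y t z.
Proof. by rewrite /fpt (dhC t z); case=> ?; [right|left]; lra. Qed.

Let fpt_sym3 D x y z t : fpt D x y z t -> fpt D z t x y.
Proof.
by rewrite /fpt (dhC z x) (dhC t y) (dhC z y) (dhC t x); case=> ?; [left|right]; lra.
Qed.

Let fpt40 x y z t : E x y -> E x z -> E x t ->
  s x = s y -> s x = s z -> s x = s t -> fpt (delta + 4 * C) x y z t.
Proof.
move=> xy xz xt sy sz st.
have [? ?] := same_sheet xy sy; have [? ?] := same_sheet xz sz.
have [? ?] := same_sheet xt st.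
have [? ?] := same_sheet (ED (EC xy) xz) (etrans (esym sy) sz).
have [? ?] := same_sheet (ED (EC xy) xt) (etrans (esym sy) st).
have [? ?] := same_sheet (ED (EC xz) xt) (etrans (esym sz) st).
by have [h|h] := @fp (pr x) (pr y) (pr z) (pr t) I I I; [left|right]; lra.
Qed.

(** Every route to [t] passes through the projection [w p] of [pr t], so [t] acts as [w p] with one
    fixed length added to both sides of the inequality. *)
Let fpt31 x y z t : E x y -> E x z -> E x t ->
  s x = s y -> s x = s z -> s x <> s t -> fpt (delta + 4 * C + c) x y z t.
Proof.
move=> xy xz xt sy sz st.
have [? ?] := same_sheet xy sy; have [? ?] := same_sheet xz sz.
have [? ?] := same_sheet (ED (EC xy) xz) (etrans (esym sy) sz).
have [p np] := cross_near xt st.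
have [? ?] := cross_sheet xt st np.
have syt : s y <> s t by rewrite -sy.
have szt : s z <> s t by rewrite -sz.
have [? ?] := cross_sheet (ED (EC xy) xt) syt np.
have [? ?] := cross_sheet (ED (EC xz) xt) szt np.
by have [h|h] := @fp (pr x) (pr y) (pr z) (w p) I I I; [left|right]; lra.
Qed.

Lemma neqb_trans (a b e : bool) : a <> b -> b <> e -> a = e.
Proof. by case: a; case: b; case: e. Qed.

(** The condition is applied to [pr z], [pr t] and the projections [w p], [w q] of [pr x], [pr y];
    the lengths from [pr x] to [w p] and from [pr y] to [w q] are then added to both sides. *)
Let fpt22a x y z t : E x y -> E x z -> E x t ->
  s x = s y -> s z = s t -> s x <> s z -> fpt (delta + 4 * C + 4 * c) x y z t.
Proof.
move=> xy xz xt sxy szt sxz.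
have zx := EC xz; have tx := EC xt; have zy := ED zx xy; have ty := ED tx xy.
have nzx : s z <> s x by move=> /esym.
have ntx : s t <> s x by rewrite -szt => /esym.
have nzy : s z <> s y by rewrite -sxy => /esym.
have nty : s t <> s y by rewrite -sxy.
have [p np] := cross_near zx nzx; have [q nq] := cross_near zy nzy.
have [? ?] := same_sheet xy sxy.
have [? ?] := same_sheet (ED zx xt) szt.
have [? ?] := cross_sheet zx nzx np; have [? ?] := cross_sheet tx ntx np.
have [? ?] := cross_sheet zy nzy nq; have [? ?] := cross_sheet ty nty nq.
have := pmD dm (pr x) (w p) (pr y); have := pmD dm (w p) (w q) (pr y).
rewrite /fpt (dhC x z) (dhC x t) (dhC y z) (dhC y t).
have := @fp (w p) (w q) (pr z) (pr t) I I I.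
have ? := pmC dm (pr x) (w p).
have ? := pmC dm (pr z) (w p); have ? := pmC dm (pr t) (w p).
have ? := pmC dm (pr z) (w q); have ? := pmC dm (pr t) (w q).
have c0 : 0 <= c.
  by have := near_gap p np; rewrite (pm0 dm); lra.
by move=> [h|h] h1 h2; [left|right]; lra.
Qed.

(** Projection to a quasi-convex set: either a geodesic from [u] to [v] nearly runs through both
    projections, or these are close together. It follows from the four-point condition on [u], [v]
    and their projections, with [near_gap] applied twice. *)
Lemma near_dichotomy u v p q : near u p -> near v q ->
  d u (w p) + d (w p) (w q) + d (w q) v <= d u v + delta + 2 * c \/
  d (w p) (w q) <= delta + c.
Proof.
move=> np nq.
have := near_gap q np; have := near_gap p nq; have := nq p.
have := @fp u (w q) v (w p) I I I.
have ? := pmC dm (w q) (w p); have ? := pmC dm v (w p).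
have ? := pmC dm v (w q); have := np q.
by move=> ? [h|h] ? ? ?; [left|right]; lra.
Qed.

(** With [w p], [w q] the projections of [pr x], [pr z]: if they are close, the two sums of crossing
    distances nearly agree. Otherwise [d (pr x) (pr z)] contains [d (w p) (w q)], and the condition
    on [w p], [pr y], [w q], [pr t] decides. *)
Let fpt22b x y z t : E x y -> E x z -> E x t ->
  s x = s z -> s y = s t -> s x <> s y ->
  fpt (2 * delta + 4 * C + 10 * c) x y z t.
Proof.
move=> xy xz xt sxz syt sxy.
have yx := EC xy; have tx := EC xt; have zx := EC xz.
have yz := ED yx xz; have tz := ED tx xz.
have nyx : s y <> s x by move=> /esym.
have ntx : s t <> s x by rewrite -syt => /esym.
have nyz : s y <> s z by rewrite -sxz => /esym.
have ntz : s t <> s z by rewrite -sxz -syt => /esym.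
have [p np] := cross_near yx nyx; have [q nq] := cross_near yz nyz.
have [? ?] := same_sheet xz sxz.
have [? ?] := same_sheet (ED yx xt) syt.
have [? ?] := cross_sheet yx nyx np; have [? ?] := cross_sheet tx ntx np.
have [? ?] := cross_sheet yz nyz nq; have [? ?] := cross_sheet tz ntz nq.
have := pmD dm (pr y) (w q) (w p); have := pmD dm (pr t) (w p) (w q).
have := near_dichotomy np nq; have := @fp (w p) (pr y) (w q) (pr t) I I I.
rewrite /fpt (dhC x y) (dhC x t) (dhC z t).
have ? := pmC dm (w q) (w p).
have ? := pmC dm (pr y) (w p); have ? := pmC dm (pr t) (w p).
have ? := pmC dm (pr y) (w q); have ? := pmC dm (pr t) (w q).
have ? := pmC dm (pr x) (w p); have ? := pmC dm (pr z) (w q).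
have c0 : 0 <= c.
  by have := near_gap p np; rewrite (pm0 dm); lra.
have d0 : 0 <= delta.
  by have := @fp (w p) (w p) (w p) (w p) I I I; rewrite !(pm0 dm); case; lra.
move=> f [h|h] h1 h2; last by right; lra.
by case: f => f; [left|right]; lra.
Qed.

Lemma four_point_double : exists delta', four_point E dh delta'.
Proof.
(* Absolute values, as no sign is assumed for [delta] and [c]; this [D] dominates the constants of
   all the cases. *)
pose D := 2 * `|delta| + 4 * C + 10 * `|c|; exists D => x y z t xy xz xt.
rewrite -/(fpt D x y z t).
have hd := ler_norm delta; have hc := ler_norm c.
have h1 := normr_ge0 delta; have h2 := normr_ge0 c.
have yx := EC xy; have zx := EC xz; have tx := EC xt.
have zy := ED zx xy; have zt := ED zx xt; have ty := ED tx xy; have tz := EC zt.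
have yz := EC zy; have yt := EC ty.
have [e1|e1] := pselect (s x = s y); have [e2|e2] := pselect (s x = s z);
  have [e3|e3] := pselect (s x = s t).
- by apply: fptW (fpt40 xy xz xt e1 e2 e3) _; rewrite /D; lra.
- by apply: fptW (fpt31 xy xz xt e1 e2 e3) _; rewrite /D; lra.
- apply: fptW (fpt_sym2 (fpt31 xy xt xz e1 e3 e2)) _; rewrite /D; lra.
- apply: fptW (fpt22a xy xz xt e1 (neqb_trans (nesym e2) e3) e2) _; rewrite /D; lra.
- apply: fptW (fpt_sym3 (fpt31 zt zx zy _ _ _)) _; rewrite /D -?e2 //; lra.
- apply: fptW (fpt22b xy xz xt e2 (neqb_trans (nesym e1) e3) e1) _; rewrite /D; lra.
- apply: fptW (fpt_sym2 (fpt22b xy xt xz e3 (neqb_trans (nesym e1) e2) e1)) _.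
  by rewrite /D; lra.
- apply: fptW (fpt_sym1 (fpt_sym3 (fpt31 zt zy zx _ _ _))) _; rewrite /D.
  + exact: neqb_trans (nesym e2) e3.
  + exact: neqb_trans (nesym e2) e1.
  + exact: nesym.
  + lra.
Qed.

End FourPoint.
End Doubling.

(** * Geodesics stay close to quasi-geodesics *)

Lemma ex_minimal_nat (P : nat -> Prop) :
  (exists n, P n) -> exists2 n, P n & forall m, P m -> (n <= m)%N.
Proof.
move=> [n Pn]; have ex : exists m, `[< P m >] by exists n; apply/asboolP.
case: (ex_minnP ex) => m /asboolP Pm mmin; exists m => // k Pk.
by apply: mmin; apply/asboolP.
Qed.

Lemma expn2_above (m : nat) : exists k, (m <= 2 ^ k <= m.*2.+1)%N.
Proof.
elim: m => [|m [k /andP[mk km]]]; first by exists 0%N.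
have [mk'|km'] := ltnP m (2 ^ k); first by exists k; rewrite mk' /=; lia.
exists k.+1; rewrite expnS; have := expn_gt0 2 k; lia.
Qed.

Lemma sqrn_le_expn2 k : (k * k <= 2 * 2 ^ k)%N.
Proof.
have h j : (j.*2.+1 <= 2 * 2 ^ j)%N.
  by elim: j => // j; rewrite expnS; lia.
by elim: k => // k IH; have := h k; rewrite expnS; lia.
Qed.

(** Exponential growth beats affine growth, with an explicit threshold obtained from
    [k * k <= 2 * 2 ^ k]. *)
Lemma expn2_affine_bound (R : realType) (a b : R) : 0 <= a -> 0 <= b ->
  forall k : nat, (2 ^ k)%:R <= a + b * k%:R -> k%:R <= 2 * a + 2 * b + 1.
Proof.
move=> a0 b0 k hk; rewrite leNgt; apply/negP => kgt.
have : (k * k)%:R <= (2 * 2 ^ k)%:R :> R by rewrite ler_nat sqrn_le_expn2.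
have k1 : 1 <= k%:R :> R by lra.
rewrite !natrM => h.
have : k%:R * (2 * a + 2 * b + 1) < k%:R * k%:R :> R.
  by rewrite ltr_pM2l //; lra.
have : 2 * a * 1 <= 2 * a * k%:R by apply: ler_wpM2l => //; lra.
nra.
Qed.

Section Hyperbolic.
Variables (R : realType) (T : Type) (d : T -> T -> R) (delta : R).
Hypothesis dm : pmetric d.
Hypothesis fp : four_point (fun _ _ => True) d delta.

(** Twice the Gromov product of [a] and [b] with base point [x]. *)
Let gp2 x a b := d x a + d x b - d a b.

Let delta_ge0 (x : T) : 0 <= delta.
Proof. by have := @fp x x x x I I I; rewrite !(pm0 dm); case; lra. Qed.

Lemma gromov_product_trans (c : R) x a e b :
  c <= gp2 x a e -> c <= gp2 x e b -> c - delta <= gp2 x a b.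
Proof.
by have := @fp x e a b I I I; rewrite /gp2 (pmC dm e a); case; lra.
Qed.

(** Halving the chain loses [delta] once per level, so the loss is only logarithmic in its length.
    This is what makes the Morse lemma work. *)
Lemma gromov_product_chain (c : R) (x : T) (z : nat -> T) (lo hi : nat) :
  (forall i, (lo <= i <= hi)%N -> c <= gp2 x (z i) (z i)) ->
  (forall i, (lo <= i < hi)%N -> c <= gp2 x (z i) (z i.+1)) ->
  forall k i j, (lo <= i)%N -> (i <= j)%N -> (j <= hi)%N -> (j <= i + 2 ^ k)%N ->
    c - k%:R * delta <= gp2 x (z i) (z j).
Proof.
have d0 := delta_ge0 x.
move=> h0 h1; elim=> [|k IH] i j loi ij jhi.
  rewrite mul0r subr0 addn1 => ji.
  have [<-|ji'] := eqVneq i j; first by apply: h0; lia.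
  have -> : j = i.+1 by lia.
  by apply: h1; lia.
rewrite expnS => ji; have h := expn_gt0 2 k.
rewrite -natr1 mulrDl mul1r opprD addrA.
apply: (gromov_product_trans (e := z (minn j (i + 2 ^ k)))).
  by apply: IH; lia.
by apply: IH; lia.
Qed.

(** The hypotheses place [q], up to [e], at the branch point of the tripod of [x], [a], [b] on the
    side from [a] to [b]. *)
Lemma gromov_projection x a b q (e : R) :
  2 * d a q <= d x a + d a b - d x b + 2 * e ->
  2 * d q b <= d a b + d x b - d x a + 2 * e ->
  2 * d x q <= d x a + d x b - d a b + 2 * (delta + e).
Proof.
by have := @fp x q a b I I I; rewrite (pmC dm q a); case; lra.
Qed.

(** Let [D] be the least integer such that the geodesic [h] stays within [D] of the chain, and [x] a
    point of [h] that nearly needs it. Seen from [x], two points of [h] on either side have Gromov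
    product zero. They are also linked through the chain, which stays far from [x] and has length
    linear in [D], so their product is at least about [D] minus a multiple of [log D]. Hence [D] is
    bounded. *)
Lemma geodesic_near_chain (lam A : R) : 0 <= lam -> 0 <= A ->
  exists2 C, 0 <= C & forall (y h : nat -> T) (N n : nat),
    (forall i, (i < N)%N -> d (y i) (y i.+1) <= lam) ->
    (forall i j, (i <= j <= N)%N -> (j - i)%:R <= A * d (y i) (y j) + A) ->
    (forall i j, (i <= j <= n)%N -> d (h i) (h j) = (j - i)%:R) ->
    h 0%N = y 0%N -> h n = y N ->
    forall i, (i <= n)%N -> exists2 k, (k <= N)%N & d (h i) (y k) <= C.
Proof.
move=> lam0 A0.
pose dlt := `|delta|; have dlt0 : 0 <= dlt by exact: normr_ge0.
(* These coefficients come from [2 ^ k <= 2 * m + 1], [m <= 6 * A * D + A] and the bound [DB] of [D]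
   by an affine function of [k]. *)
pose a := 12 * A * (dlt + lam + 1) + 2 * A + 1; pose b := 6 * A * dlt.
have Ad0 : 0 <= A * dlt by exact: mulr_ge0.
have Al0 : 0 <= A * lam by exact: mulr_ge0.
have a0 : 0 <= a by rewrite /a; nra.
have b0 : 0 <= b by rewrite /b; nra.
pose C := lam + 1 + (2 * a + 2 * b + 3) * dlt.
exists C; first by rewrite /C; nra.
move=> y h N n ylam yA hd h0 hn.
pose P D := forall i, (i <= n)%N -> exists2 k, (k <= N)%N & d (h i) (y k) <= D%:R.
have [D PD Dmin] : exists2 D, P D & forall m, P m -> (D <= m)%N.
  apply: ex_minimal_nat; exists n => i ni; exists 0%N => //.
  by rewrite -h0 (pmC dm) hd ?ni // subn0 ler_nat.
suff DC : D%:R <= C.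
  by move=> i ni; have [k kN hk] := PD i ni; exists k => //; lra.
case: D PD Dmin => [|D'] PD Dmin; first by rewrite /C; nra.
set D := D'.+1 in PD *.
have [i0 i0n far] : exists2 i, (i <= n)%N &
    forall k, (k <= N)%N -> D'%:R < d (h i) (y k).
  apply: contrapT => nex; have : P D'; last by move=> /Dmin; rewrite ltnn.
  move=> i ni; apply: contrapT => nk; apply: nex; exists i => // k kN.
  by rewrite ltNge; apply/negP => le; apply: nk; exists k.
(* Go [2 * D] away from [x] along the geodesic in both directions, stopping at its ends; the
   truncated subtraction yields [0] there. *)
have [i1 [i10 i1le i1D]] : exists i1, [/\ i1 <= i0, i0 - i1 <= 2 * D
    & i1 = 0 \/ i0 - i1 = 2 * D]%N.
  by exists (i0 - 2 * D)%N; clear; split; lia.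
have [i2 [i02 i2n i2le i2D]] : exists i2, [/\ i0 <= i2, i2 <= n, i2 - i0 <= 2 * D
    & i2 = n \/ i2 - i0 = 2 * D]%N.
  by exists (minn n (i0 + 2 * D)); move: i0n; clear; split; lia.
have DE : D%:R = D'%:R + 1 :> R by rewrite -natr1.
set x := h i0 in far.
have d0 := delta_ge0 x.
have dltE : dlt = delta by rewrite /dlt ger0_norm.
(* The links between [h] and the chain keep a product of at least [2 * D']: at an end the link is a
   single point, and otherwise distance [2 * D] from [x] leaves room for a link of length [D]. *)
have step i : (i <= n)%N -> i = 0%N \/ i = n \/ d x (h i) = (2 * D)%:R ->
    exists2 k, (k <= N)%N & d (h i) (y k) <= D%:R /\ 2 * D'%:R <= gp2 x (h i) (y k).
  move=> ni [i00|[iin|xi]].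
  - exists 0%N => //; rewrite i00 h0 (pm0 dm); split; first exact: ler0n.
    by have := far 0%N isT; rewrite /gp2 (pm0 dm); lra.
  - exists N => //; rewrite iin hn (pm0 dm); split; first exact: ler0n.
    by have := far N (leqnn N); rewrite /gp2 (pm0 dm); lra.
  - have [k kN hk] := PD i ni; exists k => //; split => //.
    have := pmD dm x (y k) (h i); rewrite (pmC dm (y k)) /gp2.
    move: xi hk; rewrite natrM DE; lra.
have dx1 : d x (h i1) = (i0 - i1)%:R by rewrite (pmC dm) hd // i10.
have dx2 : d x (h i2) = (i2 - i0)%:R by rewrite hd // i02.
have [k1 k1N [hk1 gk1]] := step i1 (leq_trans i10 i0n)
  (ltac:(by case: i1D => [->|<-]; [left|right; right])).
have [k2 k2N [hk2 gk2]] := step i2 i2n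
  (ltac:(by case: i2D => [->|<-]; right; [left|right])).
set x1 := h _ in hk1 gk1 dx1; set x2 := h _ in hk2 gk2 dx2.
(* The term [2 * lam] pays for the steps of the chain. *)
pose c : R := 2 * D'%:R - 2 * lam.
have d12 : d x1 x2 = (i2 - i1)%:R by rewrite hd // (leq_trans i10 i02).
have xx : gp2 x x1 x2 = 0.
  rewrite /gp2 dx1 dx2 d12 !natrB ?(leq_trans i10 i02) //; lra.
have x12 : d x1 x2 <= 4 * D%:R.
  have : (i0 - i1)%:R <= (2 * D)%:R :> R by rewrite ler_nat.
  have : (i2 - i0)%:R <= (2 * D)%:R :> R by rewrite ler_nat.
  by rewrite d12 !natrB ?(leq_trans i10 i02) // natrM; lra.
pose m := (maxn k1 k2 - minn k1 k2)%N.
have yy : d (y (minn k1 k2)) (y (maxn k1 k2)) <= 6 * D%:R.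
  have : d (y k1) (y k2) <= 6 * D%:R.
    have := pmD dm (y k1) x1 (y k2); have := pmD dm x1 x2 (y k2).
    rewrite (pmC dm (y k1) x1); lra.
  by case: (leqP k1 k2) => // _; rewrite (pmC dm).
have [k /andP[mk km]] := expn2_above m.
have gyy : c - k%:R * delta <= gp2 x (y (minn k1 k2)) (y (maxn k1 k2)).
  apply: (@gromov_product_chain c x y 0 N); rewrite ?leq0n //.
  - by move=> i iN; rewrite /gp2 (pm0 dm) /c; have := far i iN; lra.
  - move=> i iN; rewrite /gp2 /c; have := far i (ltnW iN).
    have := ylam i iN; have := pmD dm x (y i.+1) (y i).
    by rewrite (pmC dm (y i.+1)); lra.
  - by rewrite geq_min leq_maxl.
  - by rewrite geq_max k1N.
  - by rewrite -leq_subLR.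
have {}gyy : c - k%:R * delta <= gp2 x (y k1) (y k2).
  move: gyy; rewrite /gp2; case: (leqP k1 k2) => // _.
  by rewrite (pmC dm (y k2) (y k1)); lra.
have kd0 : 0 <= k%:R * delta by exact: mulr_ge0.
have g1 : c - k%:R * delta - delta <= gp2 x x1 (y k2).
  by apply: gromov_product_trans gyy; rewrite /c; lra.
have g2 : c - k%:R * delta - delta - delta <= gp2 x x1 x2.
  apply: (gromov_product_trans g1).
  by move: gk2; rewrite /gp2 (pmC dm (y k2)) /c; lra.
rewrite xx /c in g2.
have DB : D%:R <= lam + 1 + (k%:R + 2) * dlt / 2 by rewrite DE dltE; lra.
have mB : m%:R <= 6 * A * D%:R + A.
  have := yA (minn k1 k2) (maxn k1 k2); rewrite -/m => /(_ _) H.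
  have {}H := H ltac:(by rewrite geq_min leq_maxl geq_max k1N).
  apply: le_trans H _; rewrite lerD2r.
  by have := ler_wpM2l A0 yy; lra.
have kB : (2 ^ k)%:R <= a + b * k%:R.
  have : (2 ^ k)%:R <= (m.*2.+1)%:R :> R by rewrite ler_nat.
  rewrite -natr1 -mul2n natrM => h2.
  have : A * D%:R <= A * (lam + 1 + (k%:R + 2) * dlt / 2) by exact: ler_wpM2l.
  by rewrite /a /b; nra.
have kk := expn2_affine_bound a0 b0 kB.
have : k%:R * dlt <= (2 * a + 2 * b + 1) * dlt by exact: ler_wpM2r.
rewrite /C; have : 0 <= a * dlt by exact: mulr_ge0.
have : 0 <= b * dlt by exact: mulr_ge0.
nra.
Qed.

End Hyperbolic.

(** * Walks, distances and colorings in graphs *)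

Lemma nuniq_split (T : eqType) (p : seq T) : ~~ uniq p ->
  exists a p1 p2 p3, p = p1 ++ a :: p2 ++ a :: p3.
Proof.
elim: p => // a p IH /=; rewrite negb_and negbK.
have [/path.splitPr[p1 p2] _|_ /= /IH[b [p1 [p2 [p3 ->]]]]] := boolP (a \in p).
  by exists a, [::], p1, p2.
by exists b, (a :: p1), p2, p3.
Qed.

Section Walks.
Variable G : sgraph.
Implicit Types (u v x y : G) (n m : nat).

Fixpoint walk n u v : Prop :=
  if n is n'.+1 then exists2 t, adj u t & walk n' t v else u = v.

Lemma walk1 u v : adj u v -> walk 1 u v.
Proof. by move=> uv; exists v. Qed.

Lemma walk_cat n m u v x : walk n u v -> walk m v x -> walk (n + m) u x.
Proof.
elim: n u => [|n IH] u /=; first by move=> ->.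
by case=> t ut tv vx; exists t => //; exact: IH.
Qed.

Lemma walk_sym n u v : walk n u v -> walk n v u.
Proof.
elim: n u => [|n IH] u /=; first by move=> ->.
move=> [t ut /IH vt]; apply: (_ : walk n.+1 v u); rewrite -addn1; apply: walk_cat vt _.
by apply: walk1; rewrite adj_sym.
Qed.

Lemma walk_path u p : path adj u p -> walk (size p) u (last u p).
Proof.
elim: p u => [|v p IH] u //= /andP[uv vp]; exists v => //; exact: IH.
Qed.

Lemma path_walk n u v : walk n u v ->
  exists p, [/\ path adj u p, last u p = v & size p = n].
Proof.
elim: n u => [|n IH] u /=; first by move=> ->; exists [::].
by move=> [t ut /IH[p [tp lp sp]]]; exists (t :: p); split; rewrite //= ?ut ?sp.
Qed.

Lemma walk_even_closed k u x : adj u x -> walk k.*2 u u.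
Proof.
move=> ux; elim: k => // k IH; rewrite doubleS; exists x => //; exists u => //.
by rewrite adj_sym.
Qed.

Definition conn u v := exists n, walk n u v.

Lemma conn_refl u : conn u u. Proof. by exists 0%N. Qed.

Lemma conn_sym u v : conn u v -> conn v u.
Proof. by move=> [n /walk_sym]; exists n. Qed.

Lemma conn_trans u v x : conn u v -> conn v x -> conn u x.
Proof. by move=> [n uv] [m vx]; exists (n + m)%N; exact: walk_cat vx. Qed.

(** The value [0] between distinct components is a default, hence the [conn] hypotheses of the
    triangle inequality. *)
Definition gd u v : nat :=
  if pselect (conn u v) is left h then s2val (cid2 (ex_minimal_nat h)) else 0%N.

Lemma gd_walk u v : conn u v -> walk (gd u v) u v.
Proof.
rewrite /gd; case: pselect => [h _|//].
exact: (s2valP (cid2 (ex_minimal_nat h))).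
Qed.

Lemma gd_le n u v : walk n u v -> (gd u v <= n)%N.
Proof.
move=> uv; rewrite /gd; case: pselect => [h|[]]; last by exists n.
by have := s2valP' (cid2 (ex_minimal_nat h)); apply.
Qed.

Lemma gd0 u : gd u u = 0%N.
Proof. by apply/eqP; rewrite -leqn0; exact: (@gd_le 0). Qed.

Lemma gdC u v : gd u v = gd v u.
Proof.
have [uv|nuv] := pselect (conn u v); last first.
  have nvu : ~ conn v u by move=> /conn_sym.
  by rewrite /gd; case: pselect => // ?; case: pselect.
have vu := conn_sym uv; apply/eqP; rewrite eqn_leq.
by rewrite !gd_le//; apply: walk_sym; exact: gd_walk.
Qed.

Lemma gdD u v x : conn u v -> conn v x -> (gd u x <= gd u v + gd v x)%N.
Proof. by move=> uv vx; apply: gd_le; apply: walk_cat; exact: gd_walk. Qed.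

(** A repeated vertex splits the closed walk into two shorter ones, one of which is odd. Without
    repetition it is a cycle, as length one would need a loop. *)
Lemma odd_closed_walk_cycle n u : odd n -> walk n u u ->
  exists2 C : seq G, odd_cycle C & (size C <= n)%N.
Proof.
have [k] := ubnP n; elim: k => // k IH in n u *.
move=> nk on /path_walk[p [up lp sp]].
have [uniqp|/nuniq_split[v [p1 [p2 [p3 pE]]]]] := boolP (uniq p).
  exists p; last by rewrite sp.
  have cp : cycle adj p.
    case: p up lp {sp uniqp} => // y p /= /andP[uy yp] lp.
    by rewrite rcons_path yp lp.
  split; last by rewrite sp.
  split; last by rewrite /ucycle cp uniqp.
  rewrite -sp in on; case: p {lp sp up uniqp} on cp => [|y [|z [|t p]]] //= _.
  by rewrite adj_irr.
move: up lp sp; rewrite pE !(cat_path, last_cat, size_cat) /=.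
rewrite !(cat_path, last_cat, size_cat) /=.
move=> /and5P[up1 v1 vp2 v2 vp3] l3 sp.
have wv : walk (size p2).+1 v v.
  rewrite -addn1; apply: walk_cat (walk_path vp2) _; exact: walk1.
have wu : walk (size p1 + (size p3).+1) u u.
  apply: walk_cat (walk_path up1) _; exists v => //.
  by have := walk_path vp3; rewrite l3.
have [ev|nev] := boolP (odd (size p2).+1).
  by have [|C oC sC] := IH _ v _ ev wv; [lia|exists C => //; lia].
have o1 : odd (size p1 + (size p3).+1) by move: on nev; rewrite -sp; lia.
by have [|C oC sC] := IH _ u _ o1 wu; [lia|exists C => //; lia].
Qed.

Lemma walk_parity : (forall C : seq G, ~ odd_cycle C) ->
  forall n m u v, walk n u v -> walk m u v -> odd n = odd m.
Proof.
move=> noC n m u v uv uv'; apply/eqP; rewrite -[_ == _]negbK; apply/negP => nm.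
have onm : odd (n + m) by rewrite oddD; case: (odd n) (odd m) nm => [] [].
by have [C /noC] := odd_closed_walk_cycle onm (walk_cat uv (walk_sym uv')).
Qed.

(** The color is the parity of the walks from a chosen vertex of the component; connectedness is not
    assumed, because the result is also applied to a subgraph. *)
Lemma two_coloring : (forall C : seq G, ~ odd_cycle C) ->
  exists c : G -> bool, forall u v, adj u v -> c u = ~~ c v.
Proof.
move=> noC.
(* The choice is made from the predicate [conn u], which by extensionality is the same for adjacent
   vertices; [v] is the value for an empty predicate. *)
pose rep (v : G) (P : G -> Prop) : G :=
  if pselect (exists u, P u) is left h then sval (cid h) else v.
have repP u : conn u (rep u (conn u)).
  rewrite /rep; case: pselect => [h|]; first exact: svalP (cid h).
  by case; exists u; exact: conn_refl.
pose c u := `[< exists2 n, odd n & walk n (rep u (conn u)) u >].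
exists c => u v uv.
have cE : conn u = conn v.
  apply/funext => t; apply/propext; split=> [ut|vt].
    by apply: conn_trans ut; exists 1%N; apply/walk_sym/walk1.
  by apply: conn_trans vt; exists 1%N; exact: walk1.
have rE : rep v (conn v) = rep u (conn u).
  rewrite -cE /rep; case: pselect => // -[]; exists u; exact: conn_refl.
have [n un] := conn_sym (repP u).
have vn : walk n.+1 (rep u (conn u)) v by rewrite -addn1; apply: walk_cat un _; exact: walk1.
have cuE : c u = odd n.
  apply/asboolP/idP => [[m om um]|on]; last by exists n.
  by rewrite (walk_parity noC un um).
have cvE : c v = odd n.+1.
  apply/asboolP/idP => [[m om um]|on]; last by exists n.+1 => //; rewrite rE.
  by rewrite rE in um; rewrite (walk_parity noC vn um).
by rewrite cuE cvE /= negbK.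
Qed.

Lemma walk_coloring (c : G -> bool) n u v :
  (forall u v, adj u v -> c u = ~~ c v) -> walk n u v -> odd n = c u (+) c v.
Proof.
move=> cP; elim: n u => [|n IH] u /=; first by move=> ->; rewrite addbb.
by move=> [t /cP-> /IH->]; rewrite addNb.
Qed.

Section Connected.
Variable R : realType.
Hypothesis connG : connected_graph G.

Lemma connected_conn u v : conn u v.
Proof. by have [_ /(_ u v)[p up <-]] := connG; exists (size p); exact: walk_path. Qed.

Lemma pmetric_gd : pmetric (fun u v : G => (gd u v)%:R : R).
Proof.
split=> [x|x y|x y z]; first by rewrite gd0.
- by rewrite gdC.
- by rewrite -natrD ler_nat gdD //; exact: connected_conn.
Qed.

Lemma ex_neighbor : ~ trivial_graph G -> forall u, exists v, adj u v.
Proof.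
move=> ntG u; apply: contrapT => nu; apply: ntG; exists u => v.
have [[|n] //= [t ut _]] := connected_conn u v.
by case: nu; exists t.
Qed.

End Connected.

End Walks.

Lemma walk_geodesic (G : sgraph) (u v : G) : conn u v ->
  exists h : nat -> G, [/\ h 0%N = u, h (gd u v) = v &
    forall i, (i < gd u v)%N -> adj (h i) (h i.+1)].
Proof.
move=> /gd_walk/path_walk[p [up lp sp]]; exists (nth u (u :: p)); split => //.
- by rewrite -sp -last_nth.
- by move=> i; rewrite -sp; move: up => /(pathP u) /(_ i).
Qed.

(** * Distances in the direct product *)

(** The even surplus [n - m] is spent going back and forth along one edge at [a]. *)
Lemma walk_extend (G : sgraph) (m n : nat) (a b t : G) :
  adj a t -> walk m a b -> (m <= n)%N -> odd m = odd n -> walk n a b.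
Proof.
move=> bt ab mn omn.
have nE : n = ((n - m)./2.*2 + m)%N.
  by have := odd_double_half (n - m); rewrite oddB // omn addbb; lia.
by rewrite nE; apply: walk_cat ab; exact: walk_even_closed bt.
Qed.

Section Product.
Variables (G1 G2 : sgraph) (J : Type) (w : J -> G1) (K0 L0 D2 : nat).
Variable kappa : G2 -> bool.
Hypothesis connG1 : connected_graph G1.
Hypothesis connG2 : connected_graph G2.
Hypothesis ntG2 : ~ trivial_graph G2.
Hypothesis kappaP : forall a b : G2, adj a b -> kappa a = ~~ kappa b.
Hypothesis diamG2 : forall a b : G2, (gd a b <= D2)%N.
Hypothesis odd_cycles_near : forall C : seq G1, odd_cycle C ->
  exists j, exists2 v, v \in C & (gd (w j) v <= K0)%N.
Hypothesis odd_loop : forall j, exists n, [/\ odd n, (n <= L0)%N & walk n (w j) (w j)].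

Let near (v : G1) := exists j, (gd (w j) v <= K0)%N.

(** All vertices of [G1] are kept; those near a center become isolated. *)
Let far_adj : rel G1 := fun u v => [&& adj u v, `[< ~ near u >] & `[< ~ near v >]].

Let far_adj_sym : symmetric far_adj.
Proof. by move=> u v; rewrite /far_adj adj_sym [X in _ && X]andbC. Qed.

Let far_adj_irr : irreflexive far_adj.
Proof. by move=> u; rewrite /far_adj adj_irr. Qed.

(** An odd cycle of the far subgraph would be one of [G1], hence have a vertex near a center, but
    such a vertex has no far edge. *)
Lemma far_coloring : exists c : G1 -> bool,
  forall u v, adj u v -> ~ near u -> ~ near v -> c u = ~~ c v.
Proof.
pose H := SGraph far_adj_sym far_adj_irr.
have [C [[sC /andP[cC uC]] oC]|c cP] := @two_coloring H; last first.
  by exists c => u v uv nu nv; apply: cP; apply/and3P; split=> //; exact/asboolP.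
have [|j [v vC jv]] := @odd_cycles_near C.
  split => //; split => //; rewrite /ucycle uC andbT.
  case: C cC {sC uC oC} => //= x p; apply: sub_path => a b /and3P[] //.
have := next_cycle cC vC => /and3P[_ /asboolP + _]; apply; by exists j.
Qed.

Lemma walk_dprod n (X Y : dprod G1 G2) :
  walk n X Y <-> walk n X.1 Y.1 /\ walk n X.2 Y.2.
Proof.
elim: n X => [|n IH] X /=.
  by case: X Y => [u a] [v b] /=; split=> [[-> ->]|[-> ->]].
split.
  move=> [[t e] /andP[/= ut ae] /IH[/= tv eb]].
  by split; [exists t|exists e].
move=> [[t ut tv] [e ae eb]]; exists (t, e); first by apply/andP.
exact/IH.
Qed.

Variable c : G1 -> bool.
Hypothesis cP : forall u v, adj u v -> ~ near u -> ~ near v -> c u = ~~ c v.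

Lemma walk_coloring_or_near n u v : walk n u v ->
  odd n = c u (+) c v \/
  exists t n1 n2, [/\ n = (n1 + n2)%N, near t, walk n1 u t & walk n2 t v].
Proof.
elim: n u => [|n IH] u /=; first by move=> ->; left; rewrite addbb.
move=> [t ut tv]; have [nu|fu] := pselect (near u).
  by right; exists u, 0%N, n.+1; split => //; exists t.
have [nt|ft] := pselect (near t).
  by right; exists t, 1%N, n; split => //; exact: walk1.
have [->|[x [n1 [n2 [-> nx tx xv]]]]] := IH _ tv.
  by left; rewrite (cP ut fu ft) addNb.
by right; exists x, n1.+1, n2; split => //; exists t.
Qed.

Lemma near_detour n1 n2 t u v : near t -> walk n1 u t -> walk n2 t v ->
  exists j, (gd u (w j) + gd (w j) v <= n1 + n2 + 2 * K0)%N.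
Proof.
have cn x y := connected_conn connG1 x y.
move=> [j jt] ut tv; exists j.
have := gdD (cn u t) (cn t (w j)); have := gdD (cn (w j) t) (cn t v).
by have := gd_le ut; have := gd_le tv; rewrite (gdC t (w j)); lia.
Qed.

(** Along an edge of the product whose first coordinates are far from the centers both colors flip,
    so the sheet is preserved. *)
Definition sheet (X : dprod G1 G2) : bool := c X.1 (+) kappa X.2.

Lemma cross_sheet_lower n (X Y : dprod G1 G2) : walk n X Y -> sheet X <> sheet Y ->
  exists j, (gd X.1 (w j) + gd (w j) Y.1 <= n + 2 * K0)%N.
Proof.
move=> /walk_dprod[uv ab] sXY.
have [on|[t [n1 [n2 [-> nt ut tv]]]]] := walk_coloring_or_near uv; last first.
  exact: near_detour nt ut tv.
case: sXY; rewrite /sheet; move: on; rewrite (walk_coloring kappaP ab).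
by case: (c X.1) (c Y.1) (kappa X.2) (kappa Y.2) => [] [] [] [].
Qed.

(** A walk of the product is a pair of walks of equal length. The even margin [2 * D2] keeps the
    parity of [m] and leaves room for a shortest walk in [G2]; both factors are then lengthened by
    [walk_extend]. *)
Lemma walk_dprod_extend m (X Y : dprod G1 G2) t : adj X.1 t ->
  walk m X.1 Y.1 -> odd m = kappa X.2 (+) kappa Y.2 -> walk (m + 2 * D2) X Y.
Proof.
move=> ut uv om; apply/walk_dprod; split.
  by apply: walk_extend ut uv _ _; rewrite ?leq_addr // oddD oddM /= addbF.
have [e ae] := ex_neighbor connG2 ntG2 X.2.
have ab := gd_walk (connected_conn connG2 X.2 Y.2).
apply: (walk_extend ae ab); first by have := diamG2 X.2 Y.2; lia.
by rewrite oddD oddM /= addbF om (walk_coloring kappaP ab).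
Qed.

(** Going through [w j], the odd loop there is inserted or not, according to the parity required by
    the second factor. *)
Lemma cross_sheet_upper j (X Y : dprod G1 G2) :
  exists2 n, walk n X Y & (n <= gd X.1 (w j) + gd (w j) Y.1 + (L0 + 2 * D2))%N.
Proof.
have cn x y := connected_conn connG1 x y.
have [l [ol lL ll]] := odd_loop j.
have [t ut] : exists t, adj X.1 t.
  have : exists t, adj (w j) t by case: l ol ll {lL} => //= l _ [t jt _]; exists t.
  move=> [t jt]; have [[|n] /=] := cn X.1 (w j); first by move=> ->; exists t.
  by move=> [x ux _]; exists x.
have w0 := walk_cat (gd_walk (cn X.1 (w j))) (gd_walk (cn (w j) Y.1)).
have w1 := walk_cat (gd_walk (cn X.1 (w j))) (walk_cat ll (gd_walk (cn (w j) Y.1))).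
have [e|e] := eqVneq (odd (gd X.1 (w j) + gd (w j) Y.1)) (kappa X.2 (+) kappa Y.2).
  by exists (gd X.1 (w j) + gd (w j) Y.1 + 2 * D2)%N; [exact: walk_dprod_extend ut w0 e|lia].
exists (gd X.1 (w j) + (l + gd (w j) Y.1) + 2 * D2)%N; last lia.
apply: (walk_dprod_extend ut w1); move: e; rewrite !oddD ol.
by case: (odd (gd X.1 _)) (odd (gd _ Y.1)) (kappa X.2) (kappa Y.2) => [] [] [] [].
Qed.

(** A geodesic of [G1] avoiding the balls has the parity required by the second factor; any other
    one passes near some [w j], where the parity can be corrected. *)
Lemma same_sheet_upper (X Y : dprod G1 G2) t : adj X.1 t -> sheet X = sheet Y ->
  exists2 n, walk n X Y & (n <= gd X.1 Y.1 + (2 * K0 + L0 + 2 * D2))%N.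
Proof.
move=> ut sXY; have uv := gd_walk (connected_conn connG1 X.1 Y.1).
have [on|[x [n1 [n2 [nE nx ux xv]]]]] := walk_coloring_or_near uv.
  exists (gd X.1 Y.1 + 2 * D2)%N; last lia.
  apply: walk_dprod_extend ut uv _; rewrite on; move: sXY; rewrite /sheet.
  by case: (c X.1) (c Y.1) (kappa X.2) (kappa Y.2) => [] [] [] [].
have [j hj] := near_detour nx ux xv.
by have [n XY nle] := cross_sheet_upper j X Y; exists n => //; lia.
Qed.

Section Distances.
Variable R : realType.
Let d (u v : G1) : R := (gd u v)%:R.
Let dh (X Y : dprod G1 G2) : R := (gd X Y)%:R.
Let C : R := (2 * K0 + L0 + 2 * D2)%:R.

Lemma same_sheet_gd (X Y : dprod G1 G2) : conn X Y -> sheet X = sheet Y ->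
  d X.1 Y.1 <= dh X Y + C /\ dh X Y <= d X.1 Y.1 + C.
Proof.
move=> XY sXY; rewrite /d /dh /C -!natrD !ler_nat; split.
  have [/gd_le h _] := (walk_dprod _ _ _).1 (gd_walk XY); exact: leq_trans h (leq_addr _ _).
(* If [X.1] is isolated then so is [X], and connectedness forces [X = Y]. *)
have [[t ut]|nt] := pselect (exists t, adj X.1 t).
  have [n Xn hn] := same_sheet_upper ut sXY; exact: leq_trans (gd_le Xn) hn.
case: XY => -[|n] /= => [->|[Z /andP[XZ _] _]]; first by rewrite !gd0.
by case: nt; exists Z.1.
Qed.

Lemma cross_sheet_gd_le (X Y : dprod G1 G2) j : conn X Y -> sheet X <> sheet Y ->
  dh X Y <= d X.1 (w j) + d (w j) Y.1 + C.
Proof.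
move=> XY sXY; rewrite /d /dh /C -!natrD !ler_nat.
have [n Xn hn] := cross_sheet_upper j X Y; have := gd_le Xn; lia.
Qed.

Lemma cross_sheet_gd_ge (X Y : dprod G1 G2) : conn X Y -> sheet X <> sheet Y ->
  exists j, d X.1 (w j) + d (w j) Y.1 <= dh X Y + C.
Proof.
move=> XY sXY; have [j hj] := cross_sheet_lower (gd_walk XY) sXY.
by exists j; rewrite /d /dh /C -!natrD ler_nat; lia.
Qed.

Lemma four_point_dprod (delta c0 : R) :
  four_point (fun _ _ => True) d delta -> quasi_convex d w c0 ->
  exists delta', four_point (@conn (dprod G1 G2)) dh delta'.
Proof.
move=> fp qc.
apply: (@four_point_double R G1 J (dprod G1 G2) d w (@conn _) fst sheet dh C) fp qc _.
- exact: pmetric_gd.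
- exact: conn_sym.
- exact: conn_trans.
- by move=> X Y; rewrite /dh gdC.
- exact: same_sheet_gd.
- by move=> X Y j; exact: cross_sheet_gd_le.
- exact: cross_sheet_gd_ge.
- move=> [j0] u.
  have [|n [j jn] jmin] := @ex_minimal_nat (fun n => exists j, gd u (w j) = n).
    by exists (gd u (w j0)), j0.
  by exists j => k; rewrite ler_nat jn; apply: jmin; exists k.
Qed.

Lemma dprod_four_point (delta : R) :
  four_point (@conn (dprod G1 G2)) dh delta ->
  (exists delta', four_point (fun _ _ => True) d delta') /\
  exists c0, quasi_convex d w c0.
Proof.
move=> fp.
have [[G1_0] _] := connG1; have [[a0] _] := connG2.
(* A connected [G1] without an edge at some vertex is a single point, where both claims are trivial.
   Otherwise every vertex has a neighbor and both sheets are connected. *)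
have [[t0 ut0]|nt] := pselect (exists t, adj G1_0 t); last first.
  have eq u : u = G1_0.
    have [[|n] /=] := connected_conn connG1 G1_0 u => // -[t ut _].
    by case: nt; exists t.
  split.
    by exists 0 => x y z t _ _ _; left; rewrite (eq x) (eq y) (eq z) (eq t) /d gd0; lra.
  exists 0 => x j k; exists j; rewrite (eq x) (eq (w j)) (eq (w k)) /d gd0; lra.
have [a1 a01] := ex_neighbor connG2 ntG2 a0.
have nb (u : G1) : exists t, adj u t.
  have [[|n] /=] := connected_conn connG1 u G1_0; first by move=> ->; exists t0.
  by move=> [t ut _]; exists t.
have lift (b : bool) u : exists2 X, X.1 = u & sheet X = b.
  have [e|e] := eqVneq (c u (+) kappa a0) b; first by exists (u, a0).
  exists (u, a1) => //; move: e; rewrite /sheet (kappaP a01) /=.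
  by case: (c u) (kappa a1) b => [] [] [].
have sameC X Y : sheet X = sheet Y -> conn X Y.
  move=> sXY; have [t ut] := nb X.1.
  by have [n h _] := same_sheet_upper ut sXY; exists n.
split.
  exists (delta + 4 * C) => x y z t _ _ _.
  have [X <- sX] := lift true x; have [Y <- sY] := lift true y.
  have [Z <- sZ] := lift true z; have [T <- sT] := lift true t.
  have cc U V : sheet U = true -> sheet V = true ->
      conn U V /\ (d U.1 V.1 <= dh U V + C /\ dh U V <= d U.1 V.1 + C).
    by move=> sU sV; have UV := sameC U V (etrans sU (esym sV));
      split => //; apply: same_sheet_gd => //; rewrite sU sV.
  have [XY [? ?]] := cc _ _ sX sY; have [XZ [? ?]] := cc _ _ sX sZ.
  have [XT [? ?]] := cc _ _ sX sT; have [YZ [? ?]] := cc _ _ sY sZ.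
  have [YT [? ?]] := cc _ _ sY sT; have [ZT [? ?]] := cc _ _ sZ sT.
  by have [h|h] := fp _ _ _ _ XY XZ XT; [left|right]; lra.
exists (delta + 4 * C).
apply: (@quasi_convex_double R G1 J (dprod G1 G2) d w (@conn _) fst sheet dh C) fp _.
- exact: pmetric_gd.
- exact: conn_sym.
- exact: conn_trans.
- exact: same_sheet_gd.
- by move=> X Y j; exact: cross_sheet_gd_le.
- exact: cross_sheet_gd_ge.
- move=> x j k.
  have [X0 <- s0] := lift true x; have [X1 p1 s1] := lift false X0.1.
  have [Yj pj sj] := lift true (w j); have [Yk pk sk] := lift true (w k).
  exists X0, X1, Yj, Yk; rewrite s0 s1 sj sk; do !split => //.
  + by have [n h _] := cross_sheet_upper j X0 X1; exists n.
  + by apply: sameC; rewrite s0 sj.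
  + by apply: sameC; rewrite s0 sk.
Qed.

End Distances.
End Product.

(** * Distances in the geometric realization *)

Section RealizationMetric.
Variables (R : realType) (G : sgraph).
Implicit Types (u v : G) (x y z : gpoint R G) (l s t : R).

Let vp (v : G) : gpoint R G := vpoint R v.

Lemma gpoint_eq x y : bary x = bary y -> x = y.
Proof.
case: x y => [f fP] [g gP] /= fg; subst g; congr GPoint; exact: Prop_irrelevance.
Qed.

Lemma bary_vertexE v : bary_vertex R v v = 1.
Proof. by rewrite /bary_vertex eqxx. Qed.

Lemma bary_edgeL u v t : adj u v -> bary_edge u v t u = 1 - t.
Proof.
move=> uv; rewrite /bary_edge /bary_vertex eqxx.
have -> : (u == v) = false by apply/eqP => e; rewrite e adj_irr in uv.
by rewrite mulr1 mulr0 addr0.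
Qed.

Lemma bary_edge_sym u v t : bary_edge u v t = bary_edge v u (1 - t).
Proof. by apply/funext => w; rewrite /bary_edge; ring. Qed.

Lemma bary_edgeR u v t : adj u v -> bary_edge u v t v = t.
Proof. by rewrite adj_sym => vu; rewrite bary_edge_sym bary_edgeL // subKr. Qed.

Lemma bary_edge0 u v : bary_edge u v 0 = bary_vertex R u.
Proof. by apply/funext => w; rewrite /bary_edge; ring. Qed.

Lemma bary_edge1 u v : bary_edge u v 1 = bary_vertex R v.
Proof. by apply/funext => w; rewrite /bary_edge; ring. Qed.

Lemma bary_edge_supp u v t (w : G) : bary_edge u v t w != 0 -> w = u \/ w = v.
Proof.
rewrite /bary_edge /bary_vertex.
have [->|nu] := eqVneq w u; first by left.
by have [->|nv] := eqVneq w v; [right|rewrite !mulr0 addr0 eqxx].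
Qed.

(* A path from the vertex [u] to the point [y] reaches [y] through an end [v]
   of the edge containing [y], at distance [1 - y v] of [y]. *)
Lemma bpath_from_vertex u y l : bpath (vp u) y l ->
  exists v n, [/\ walk n u v, 0 < y v & n%:R + (1 - y v) <= l].
Proof.
elim=> [|y' z m a b s t _ [v [n [uv yv le]]] ab s01 t01 yE zE].
  by exists u, 0%N; rewrite /= bary_vertexE subrr addr0; split => //; exact: ltr01.
have st := ler_norm (s - t); have ts := ler_norm (t - s); rewrite distrC in ts.
rewrite zE; move/andP: s01 => [s0 s1]; move/andP: t01 => [t0 t1].
have [va|vb] : v = a \/ v = b by apply: (@bary_edge_supp a b s); rewrite -yE gt_eqF.
- subst v; rewrite yE bary_edgeL // in le yv.
  have [tlt|tge] := ltP t 1.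
    by exists a, n; rewrite bary_edgeL //; split => //; lra.
  exists b, (n + 1)%N; rewrite bary_edgeR //; split; last by rewrite natrD; lra.
    by apply: walk_cat uv _; exact: walk1.
  lra.
- subst v; rewrite yE bary_edgeR // in le yv.
  have [tgt|tle] := ltP 0 t.
    by exists b, n; rewrite bary_edgeR //; split => //; lra.
  exists a, (n + 1)%N; rewrite bary_edgeL //; split; last by rewrite natrD; lra.
    by apply: walk_cat uv _; apply: walk1; rewrite adj_sym.
  lra.
Qed.

Lemma bpath_walk u v l : bpath (vp u) (vp v) l -> exists2 n, walk n u v & n%:R <= l.
Proof.
move=> /bpath_from_vertex[v' [n [uv' v'pos le]]].
have v'v : v' = v.
  by move: v'pos; rewrite /= /bary_vertex; case: eqVneq => // _; rewrite ltxx.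
exists n; first by rewrite -v'v.
by move: le; rewrite v'v /= bary_vertexE subrr addr0.
Qed.

Lemma bpath_edge u v s t x y : adj u v -> 0 <= s <= 1 -> 0 <= t <= 1 ->
  bary x = bary_edge u v s -> bary y = bary_edge u v t -> bpath x y `|s - t|.
Proof.
move=> uv s01 t01 xE yE; rewrite -[X in bpath _ _ X]add0r.
exact: bpath_rcons (bpath_nil x) uv s01 t01 xE yE.
Qed.

Lemma walk_bpath n u v : walk n u v -> bpath (vp u) (vp v) n%:R.
Proof.
elim: n u => [|n IH] u /=; first by move=> ->; exact: bpath_nil.
move=> [t ut /IH tv]; rewrite -natr1 addrC; apply: bpath_cat tv.
have -> : (1 : R) = `|0 - 1| by rewrite sub0r normrN normr1.
by apply: (bpath_edge ut); rewrite ?lexx ?ler01 // ?bary_edge0 ?bary_edge1.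
Qed.

Lemma bpath_to_vertex x : exists v, exists2 l, bpath x (vp v) l & l <= 1.
Proof.
case: (baryP x) => [[v xE]|[u [v [t [uv t01 xE]]]]].
  exists v, 0; last exact: ler01.
  by have -> : x = vp v by [exact: gpoint_eq]; exact: bpath_nil.
exists u, `|t - 0|; last by rewrite subr0 ger0_norm; lra.
by apply: (bpath_edge uv) => //; rewrite ?lexx ?ler01 //= bary_edge0.
Qed.

Lemma bpath_edist x y l : bpath x y l -> (edist (x, y) <= l%:E)%E.
Proof. by rewrite edist_gdist => xy; apply: ereal_inf_lbound; exists l. Qed.

Lemma edist_bpath x y l : (edist (x, y) < l%:E)%E -> exists2 m, bpath x y m & m < l.
Proof.
by rewrite edist_gdist => /ereal_inf_lt[_ [m xm <-]]; rewrite lte_fin; exists m.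
Qed.

Definition rconn x y := (edist (x, y) < +oo)%E.
(* Locked, for comparing two distances by conversion would be too costly. *)
Definition rd : gpoint R G -> gpoint R G -> R :=
  locked (fun x y => fine (edist (x, y))).

Lemma rd_fine x y : rd x y = fine (edist (x, y)).
Proof. by rewrite /rd -lock. Qed.

Lemma rdE x y : rconn x y -> edist (x, y) = (rd x y)%:E.
Proof. by move=> xy; rewrite rd_fine fineK // ge0_fin_numE // edist_ge0. Qed.

Lemma rconn_le x y l : (edist (x, y) <= l%:E)%E -> rconn x y /\ rd x y <= l.
Proof.
move=> xy; have c : rconn x y by apply: le_lt_trans xy _; exact: ltry.
by split => //; rewrite -lee_fin -rdE.
Qed.

Lemma rconn_refl x : rconn x x.
Proof. by rewrite /rconn edist_refl ltry. Qed.

Lemma rconn_sym x y : rconn x y -> rconn y x.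
Proof. by rewrite /rconn edist_sym. Qed.

Lemma rconn_trans x y z : rconn x y -> rconn y z -> rconn x z.
Proof.
move=> xy yz; apply: le_lt_trans (edist_triangle x y z) _.
by rewrite (rdE xy) (rdE yz) -EFinD ltry.
Qed.

Lemma rd0 x : rd x x = 0.
Proof. by rewrite rd_fine edist_refl. Qed.

Lemma rdC x y : rd x y = rd y x.
Proof. by rewrite !rd_fine edist_sym. Qed.

Lemma rdD x y z : rconn x y -> rconn y z -> rd x z <= rd x y + rd y z.
Proof.
move=> xy yz; rewrite -lee_fin EFinD -!rdE //; last exact: rconn_trans xy yz.
exact: edist_triangle.
Qed.

Lemma rd_vertex u v : conn u v ->
  rconn (vp u) (vp v) /\ rd (vp u) (vp v) = (gd u v)%:R.
Proof.
move=> uv; have [c le] := rconn_le (bpath_edist (walk_bpath (gd_walk uv))).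
split => //; apply/eqP; rewrite eq_le le /=; apply/ler_addgt0Pr => e e0.
have [] := @edist_bpath (vp u) (vp v) (rd (vp u) (vp v) + e).
  by rewrite rdE // lte_fin ltrDl.
move=> m /bpath_walk[n /gd_le un nm] mlt; apply: ltW; apply: le_lt_trans mlt.
by apply: le_trans nm; rewrite ler_nat.
Qed.

Lemma rconn_conn u v : rconn (vp u) (vp v) -> conn u v.
Proof.
move=> c; have [] := @edist_bpath (vp u) (vp v) (rd (vp u) (vp v) + 1).
  by rewrite rdE // lte_fin ltrDl.
by move=> m /bpath_walk[n un _] _; exists n.
Qed.

Lemma near_vertex x : exists v, rconn x (vp v) /\ rd x (vp v) <= 1.
Proof.
have [v [l xv l1]] := bpath_to_vertex x; exists v; apply: rconn_le.
by apply: le_trans (bpath_edist xv) _; rewrite lee_fin.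
Qed.

Definition nv x : G := sval (cid (near_vertex x)).

Lemma rconn_nv x : rconn x (vp (nv x)).
Proof. by have [] := svalP (cid (near_vertex x)). Qed.

Lemma rd_nv x : rd x (vp (nv x)) <= 1.
Proof. by have [] := svalP (cid (near_vertex x)). Qed.

Lemma conn_nv x y : rconn x y -> conn (nv x) (nv y).
Proof.
move=> xy; apply: rconn_conn; apply: rconn_trans (rconn_sym (rconn_nv x)) _.
exact: rconn_trans xy (rconn_nv y).
Qed.

Lemma gd_nv x y : rconn x y ->
  (gd (nv x) (nv y))%:R <= rd x y + 2 /\ rd x y <= (gd (nv x) (nv y))%:R + 2.
Proof.
move=> xy; have [c <-] := rd_vertex (conn_nv xy).
have xn := rconn_nv x; have yn := rconn_nv y; have nx := rconn_sym xn; have ny := rconn_sym yn.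
have := rd_nv x; have := rd_nv y.
have := rdD nx (rconn_trans xy yn); have := rdD xy yn.
have := rdD xn (rconn_trans c ny); have := rdD c ny.
rewrite (rdC (vp (nv x)) x) (rdC (vp (nv y)) y); lra.
Qed.

(** Moving points to nearby vertices changes each of the four distances of an inequality by at most
    [2]. *)
Lemma four_point_realization (delta : R) :
  four_point (@conn G) (fun u v => (gd u v)%:R) delta ->
  four_point rconn rd (delta + 8).
Proof.
move=> fp x y z t xy xz xt.
have yz := rconn_trans (rconn_sym xy) xz; have yt := rconn_trans (rconn_sym xy) xt.
have zt := rconn_trans (rconn_sym xz) xt.
have [? ?] := gd_nv xy; have [? ?] := gd_nv xz; have [? ?] := gd_nv xt.
have [? ?] := gd_nv yz; have [? ?] := gd_nv yt; have [? ?] := gd_nv zt.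
by have [h|h] := fp _ _ _ _ (conn_nv xy) (conn_nv xz) (conn_nv xt); [left|right]; lra.
Qed.

Lemma geodesic_mem x y S p : geodesic x y S -> S p ->
  [/\ rconn x y, rconn x p & rd x p + rd p y = rd x y].
Proof.
move=> [L [g [L0 g0 gL giso ->]]] [s /=]; rewrite in_itv /= => sL gs.
have i0 : 0 \in `[0, L] by rewrite in_itv /= lexx.
have iL : L \in `[0, L] by rewrite in_itv /= lexx andbT.
have is_ : s \in `[0, L] by rewrite in_itv.
have := giso _ _ i0 iL; have := giso _ _ i0 is_; have := giso _ _ is_ iL.
rewrite g0 gL gs /rconn !rd_fine => -> -> ->; rewrite !ltry; split => //=.
move/andP: sL => [s0 sL]; rewrite !sub0r !normrN (distrC s L) !ger0_norm ?subr_ge0 //; lra.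
Qed.

Lemma geodesic_point x y S s : geodesic x y S -> 0 <= s <= rd x y ->
  exists2 q, S q & rd x q = s /\ rd q y = rd x y - s.
Proof.
move=> [L [g [L0 g0 gL giso ->]]].
have i0 : 0 \in `[0, L] by rewrite in_itv /= lexx.
have iL : L \in `[0, L] by rewrite in_itv /= lexx andbT.
have -> : rd x y = L.
  by have := giso _ _ i0 iL; rewrite g0 gL !rd_fine => -> /=; rewrite sub0r normrN ger0_norm.
move=> sL; have is_ : s \in `[0, L] by rewrite in_itv.
exists (g s); first by exists s.
have := giso _ _ i0 is_; have := giso _ _ is_ iL.
rewrite g0 gL !rd_fine => -> -> /=; move/andP: sL => [s0 sL].
by rewrite sub0r normrN ger0_norm // distrC ger0_norm // subr_ge0.
Qed.

End RealizationMetric.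

(** * Thin triangles and the four-point condition *)

Section VertexGeodesics.
Variables (R : realType) (G : sgraph).
Implicit Types (u v : G) (x y z : gpoint R G) (l s t : R).

Let vp (v : G) : gpoint R G := vpoint R v.

(** * Shortest walks as geodesics of the realization *)

Section Path.
Variables (n : nat) (h : nat -> G).
Hypothesis h_adj : forall i, (i < n)%N -> adj (h i) (h i.+1).
Hypothesis gd_h : gd (h 0%N) (h n) = n.

Let pt (f : G -> R) : gpoint R G :=
  if pselect (is_bary f) is left p then GPoint p else vp (h 0%N).

Let ptE f : is_bary f -> bary (pt f) = f.
Proof. by rewrite /pt; case: pselect. Qed.

(** Unit-speed parametrization of the walk. At [s = n%:R] the vertex [h n.+1] is arbitrary, but its
    coefficient vanishes. *)
Let g (s : R) : gpoint R G :=
  pt (bary_edge (h (Num.truncn s)) (h (Num.truncn s).+1) (s - (Num.truncn s)%:R)).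

Let g_nat i : g i%:R = vp (h i).
Proof.
apply: gpoint_eq; rewrite /g natrK subrr bary_edge0 ptE //.
exact: is_bary_vertex.
Qed.

Let g_edge i s : (i < n)%N -> i%:R <= s <= i.+1%:R ->
  bary (g s) = bary_edge (h i) (h i.+1) (s - i%:R).
Proof.
move=> ilt /andP[si]; rewrite le_eqVlt => /orP[/eqP->|sS].
  by rewrite g_nat -natr1 addrAC subrr add0r bary_edge1.
have tE : Num.truncn s = i by apply: truncn_def; rewrite si sS.
rewrite /g tE ptE //; right; exists (h i), (h i.+1), (s - i%:R); split => //.
  exact: h_adj.
by move: sS; rewrite -natr1; lra.
Qed.

Let g_bpath k s t : (k <= n)%N -> 0 <= s -> s <= t -> t <= k%:R ->
  bpath (g s) (g t) (t - s).
Proof.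
elim: k s t => [|k IH] s t kn s0 st tk.
  have -> : s = t by lra.
  by rewrite subrr; exact: bpath_nil.
have [tk'|kt] := leP t k%:R; first exact: IH (ltnW kn) s0 st tk'.
have hk := @natr1 R k.
have edge a b : k%:R <= a -> a <= b -> b <= k.+1%:R -> bpath (g a) (g b) (b - a).
  move=> ka ab bk.
  have -> : b - a = `|(a - k%:R) - (b - k%:R)| by rewrite distrC ger0_norm; lra.
  by apply: (bpath_edge (h_adj kn) _ _ (g_edge kn _) (g_edge kn _)); apply/andP; split; lra.
have [ks|sk] := leP k%:R s; first exact: edge.
have -> : t - s = (k%:R - s) + (t - k%:R) by lra.
apply: bpath_cat; first exact: (IH s k%:R (ltnW kn) s0 (ltW sk)).
by apply: edge => //; exact: ltW.
Qed.

(** The upper bound is the length of the path. Since the ends are at distance [n], none of the three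
    pieces cut out by [s] and [t] can be shortened. *)
Let g_iso s t : 0 <= s -> s <= t -> t <= n%:R -> edist (g s, g t) = (t - s)%:E.
Proof.
move=> s0 st tn.
have [c0 d0] := rconn_le (bpath_edist (@g_bpath n 0 s (leqnn n) (lexx 0) s0 (le_trans st tn))).
have [c1 d1] := rconn_le (bpath_edist (@g_bpath n s t (leqnn n) s0 st tn)).
have [c2 d2] := rconn_le (bpath_edist (@g_bpath n t n%:R (leqnn n) (le_trans s0 st) tn (lexx _))).
have c02 := rconn_trans c0 (rconn_trans c1 c2).
rewrite rdE //; congr (_%:E); apply/eqP; rewrite eq_le d1 /=.
have := rdD c0 (rconn_trans c1 c2); have := rdD c1 c2.
have gn : rd (g 0) (g n%:R) = n%:R.
  move: c02; rewrite g_nat (g_nat 0) => /rconn_conn c; have [_ ->] := rd_vertex R c.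
  by rewrite gd_h.
rewrite gn; lra.
Qed.

Lemma vertex_geodesic : exists S,
  [/\ geodesic (vp (h 0%N)) (vp (h n)) S, (forall i, (i <= n)%N -> S (vp (h i))) &
      forall x, S x -> exists2 i, (i <= n)%N & rconn x (vp (h i)) /\ rd x (vp (h i)) <= 1].
Proof.
exists (g @` `[0, n%:R]); split.
- exists n%:R, g; split; rewrite ?ler0n ?g_nat //.
    exact: (g_nat 0).
  move=> s t; rewrite !in_itv /= => /andP[s0 sn] /andP[t0 tn].
  have [st|/ltW ts] := leP s t.
    by rewrite g_iso // distrC ger0_norm // subr_ge0.
  by rewrite edist_sym g_iso // ger0_norm // subr_ge0.
- by move=> i ni; exists i%:R; rewrite ?g_nat //= in_itv /= ler0n ler_nat.
- move=> x [s /=]; rewrite in_itv /= => /andP[s0 sn] <-.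
  have /andP[ts st] := truncn_itv s0.
  have tn : (Num.truncn s <= n)%N by rewrite -(ler_nat R); exact: le_trans ts sn.
  exists (Num.truncn s) => //; rewrite -g_nat; apply: rconn_le.
  rewrite edist_sym g_iso // lee_fin; move: st; rewrite -natr1; lra.
Qed.

Lemma gd_path i j : (i <= j <= n)%N -> conn (h i) (h j) /\ gd (h i) (h j) = (j - i)%N.
Proof.
move=> /andP[ij jn].
have wk k m : (k + m <= n)%N -> walk m (h k) (h (k + m)%N).
  elim: m => [|m IH]; first by rewrite addn0.
  move=> km; rewrite -addn1; apply: walk_cat (IH _) _; first by lia.
  by rewrite addnA addn1; apply: walk1; apply: h_adj; lia.
have w1 : walk i (h 0%N) (h i) by apply: (wk 0%N); lia.
have w2 : walk (j - i) (h i) (h j) by have := wk i (j - i)%N; rewrite subnKC //; apply.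
have w3 : walk (n - j) (h j) (h n) by have := wk j (n - j)%N; rewrite subnKC //; apply.
have cij : conn (h i) (h j) by exists (j - i)%N.
split => //; apply/eqP; rewrite eqn_leq gd_le //=.
have := gd_le (walk_cat w1 (walk_cat (gd_walk cij) w3)).
by rewrite gd_h; lia.
Qed.

End Path.

Definition between u v p := [/\ conn u p, conn p v & gd u v = (gd u p + gd p v)%N].

Lemma between_path u v p : between u v p -> exists n h,
  [/\ forall i, (i < n)%N -> adj (h i) (h i.+1), gd (h 0%N) (h n) = n,
      h 0%N = u, h n = v & exists2 i, (i <= n)%N & h i = p].
Proof.
move=> [up pv e].
have [h1 [h10 h1n h1a]] := walk_geodesic up.
have [h2 [h20 h2n h2a]] := walk_geodesic pv.
pose h i := if (i <= gd u p)%N then h1 i else h2 (i - gd u p)%N.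
have hn : h (gd u p + gd p v)%N = v.
  rewrite /h; case: leqP => [le|_]; last by rewrite addKn.
  have z : gd p v = 0%N by lia.
  by rewrite z addn0 h1n -h20 -z h2n.
exists (gd u p + gd p v)%N, h; rewrite hn; split => //.
- move=> i ilt; rewrite /h; case: (ltngtP i (gd u p)) => [lt|gt|ie].
  + exact: h1a.
  + by rewrite subSn ?(ltnW gt) //; apply: h2a; lia.
  + by rewrite ie subSnn h1n -h20; apply: h2a; lia.
- by rewrite /h leq0n h10.
- by exists (gd u p); rewrite ?leq_addr // /h leqnn.
Qed.

Lemma path_between n h i : (forall i, (i < n)%N -> adj (h i) (h i.+1)) ->
  gd (h 0%N) (h n) = n -> (i <= n)%N -> between (h 0%N) (h n) (h i).
Proof.
move=> ha hn ni.
have [c1 e1] := gd_path ha hn (ni : (0 <= i <= n)%N).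
have [c2 e2] := gd_path ha hn (ltac:(by rewrite ni leqnn) : (i <= n <= n)%N).
by split => //; rewrite e1 e2 hn; lia.
Qed.

Lemma between_geodesic u v p : between u v p -> exists S,
  [/\ geodesic (vp u) (vp v) S, S (vp p) &
      forall x, S x -> exists2 q, between u v q & rconn x (vp q) /\ rd x (vp q) <= 1].
Proof.
move=> /between_path[n [h [ha hn h0 hv [i ni hi]]]].
have [S [gS Sh Snear]] := vertex_geodesic ha hn.
rewrite -h0 -hv -hi; exists S; split => //; first exact: Sh.
by move=> x /Snear[j nj [c r]]; exists (h j) => //; exact: path_between.
Qed.

Lemma between_refl u v : conn u v -> between u v u.
Proof. by move=> uv; split => //; [exact: conn_refl|rewrite gd0]. Qed.

Lemma between_sym u v p : between u v p -> between v u p.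
Proof.
move=> [up pv e]; split; try exact: conn_sym.
by rewrite (gdC v u) e (gdC p v) (gdC u p) addnC.
Qed.

End VertexGeodesics.

(** * Hyperbolicity of the realization as a condition on vertices *)

Section Hyperbolicity.
Variables (R : realType) (G : sgraph).

Let vp (v : G) : gpoint R G := vpoint R v.
Let d (u v : G) : R := (gd u v)%:R.

Definition thin_triangles (D : R) := forall (x1 x2 x3 : gpoint R G) S1 S2 S3,
  rconn x1 x2 -> rconn x1 x3 ->
  geodesic x1 x2 S1 -> geodesic x2 x3 S2 -> geodesic x3 x1 S3 ->
  thin D S1 S2 S3.

Lemma hyperbolic_thin : hyperbolic (gpoint R G) -> exists D, thin_triangles D.
Proof.
move=> hyp.
have [D hD] : exists D : R, (hyperbolicity_constant (gpoint R G) < D%:E)%E.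
  rewrite /hyperbolic in hyp; case: (hyperbolicity_constant _) hyp => [r _||_] //.
    by exists (r + 1); rewrite lte_fin ltrDl.
  by exists 0; rewrite ltNyr.
exists D => x1 x2 x3 S1 S2 S3 x12 x13 g1 g2 g3.
have : (delta_triangle S1 S2 S3 < D%:E)%E.
  apply: le_lt_trans hD.
  apply: (@le_trans _ _ (delta_component x1)); last first.
    by apply: ereal_sup_ubound; exists x1.
  apply: ereal_sup_ubound; exists S1, S2, S3; split => //; first by exists x1, x2, x3.
  move=> p [[p1|p2]|p3].
  - by have [_ c _] := geodesic_mem g1 p1.
  - by have [_ c _] := geodesic_mem g2 p2; exact: rconn_trans x12 c.
  - by have [_ c _] := geodesic_mem g3 p3; exact: rconn_trans x13 c.
move=> /ereal_inf_lt[_ [e [e0 [t1 t2 t3]] <-]]; rewrite lte_fin => eD.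
have le (A B : set (gpoint R G)) : A `<=` neighborhood e B -> A `<=` neighborhood D B.
  by move=> AB p /AB h; apply: le_trans h _; rewrite lee_fin ltW.
by split; exact: le.
Qed.

Lemma thin_hyperbolic (D : R) : 0 <= D -> thin_triangles D -> hyperbolic (gpoint R G).
Proof.
move=> D0 thinD; apply: (@le_lt_trans _ _ D%:E); last exact: ltry.
apply: ge_ereal_sup => _ [x _ <-].
apply: ge_ereal_sup => _ [S1 [S2 [S3 [[x1 [x2 [x3 [g1 g2 g3]]]] sub ->]]]].
apply: ereal_inf_lbound; exists D => //; split => //.
have [L [g [L0 e0 eL iso SE]]] := g1; have [L' [g' [L0' e0' eL' iso' SE']]] := g3.
have m1 : S1 x1 by rewrite SE -e0; exists 0; rewrite //= in_itv /= lexx.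
have m2 : S1 x2 by rewrite SE -eL; exists L; rewrite //= in_itv /= lexx andbT.
have m3 : S3 x3 by rewrite SE' -e0'; exists 0; rewrite //= in_itv /= lexx.
have c1 : rconn x x1 by apply: sub; left; left.
have c2 : rconn x x2 by apply: sub; left; left.
have c3 : rconn x x3 by apply: sub; right.
have c1' := rconn_sym c1.
exact: (thinD _ _ _ _ _ _ (rconn_trans c1' c2) (rconn_trans c1' c3) g1 g2 g3).
Qed.

Lemma thin_four_point (D : R) : thin_triangles D ->
  exists delta, four_point (@conn G) d delta.
Proof.
(* One unit passes from the infimum defining the neighborhood to an actual point, the other from
   that point to a vertex. *)
move=> thinD; pose D' := D + 2.
have dD u v p : conn u v -> conn v p -> d u p <= d u v + d v p.
  by move=> uv vp'; rewrite /d -natrD ler_nat gdD.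
have dC u v : d u v = d v u by rewrite /d gdC.
have thinV x y z p : conn x z -> between x y p ->
    exists q, [/\ conn p q, d p q <= D' & between y z q \/ between z x q].
  move=> xz pxy; have [xp py e] := pxy; have xy := conn_trans xp py.
  have yz := conn_trans (conn_sym xy) xz.
  have [S1 [g1 S1p _]] := between_geodesic R pxy.
  have [S2 [g2 _ S2n]] := between_geodesic R (between_refl yz).
  have [S3 [g3 _ S3n]] := between_geodesic R (between_refl (conn_sym xz)).
  have [t1 _ _] := thinD _ _ _ _ _ _ (rd_vertex R xy).1 (rd_vertex R xz).1 g1 g2 g3.
  have /(le_lt_trans (t1 _ S1p)) : (D%:E < (D + 1)%:E)%E by rewrite lte_fin ltrDl.
  move=> /ereal_inf_lt[_ [q' Sq' <-] /ltW/rconn_le[cq dq]].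
  have close q : rconn q' (vp q) /\ rd q' (vp q) <= 1 -> conn p q /\ d p q <= D'.
    move=> [cq' dq']; have c := rconn_trans cq cq'; have cpq := rconn_conn c.
    have [_ E0] := rd_vertex R cpq; split => //; rewrite /d -E0.
    by have := rdD cq cq'; rewrite /D'; lra.
  case: Sq' => [/S2n|/S3n] [q bq /close[c1 c2]]; exists q; split => //; first by left.
  by right.
have insize w x y : conn w x -> conn w y -> exists2 p, between x y p &
    2 * d w p <= d w x + d w y - d x y + 4 * D' + 2.
  move=> wx wy; have xw := conn_sym wx; have xy := conn_trans xw wy.
  have [n [h [ha hn h0 hv _]]] := between_path (between_refl xy).
  pose P i := (i <= n)%N /\ exists q, [/\ conn (h i) q, d (h i) q <= D' & between y w q].
  have D'0 : 0 <= D'.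
    have [q [_ dq _]] := thinV x y w x xw (between_refl xy).
    by apply: le_trans dq; exact: ler0n.
  (* Take the first vertex of the geodesic from [x] to [y] that is close to a geodesic from [y] to
     [w]. By thinness its predecessor is close to one from [w] to [x], so this vertex is close to
     both sides. *)
  have [i [ni [q1 [pq1 dq1 [yq1 q1w e1]]]] imin] : exists2 i, P i & forall j, P j -> (i <= j)%N.
    apply: ex_minimal_nat; exists n; split => //; exists y; rewrite hv /d gd0.
    by split => //; [exact: conn_refl|apply: between_refl; exact: conn_sym].
  have [q2 [pq2 dq2 [wq2 q2x e2]]] : exists q,
      [/\ conn (h i) q, d (h i) q <= D' + 1 & between w x q].
    case: i ni imin pq1 dq1 => [|i] ni imin pq1 dq1.
      exists x; rewrite h0 /d gd0; split; [exact: conn_refl|lra|].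
      exact: between_sym (between_refl xw).
    have bi : between x y (h i) by rewrite -h0 -hv; apply: path_between; rewrite // ltnW.
    have [q [c dq [bq|bq]]] := thinV x y w (h i) xw bi.
      by have := imin i (conj (ltnW ni) (ex_intro _ q (And3 c dq bq))); rewrite ltnn.
    have c1 : conn (h i.+1) (h i) by apply: conn_sym; exists 1%N; apply: walk1; exact: ha.
    exists q; split => //; first exact: conn_trans c1 c.
    apply: le_trans (dD _ _ _ c1 c) _; rewrite addrC lerD // /d.
    by rewrite (_ : 1 = 1%:R) // ler_nat; apply: gd_le; apply: walk_sym; apply: walk1; exact: ha.
  have bi : between x y (h i) by rewrite -h0 -hv; apply: path_between.
  exists (h i) => //; have [xi iy e] := bi.
  have wi := conn_trans wx xi.
  have E0 : d x y = d x (h i) + d (h i) y by rewrite /d e natrD.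
  have E1 : d y w = d y q1 + d q1 w by rewrite /d e1 natrD.
  have E2 : d w x = d w q2 + d q2 x by rewrite /d e2 natrD.
  have := dD _ _ _ wq2 (conn_sym pq2); have := dD _ _ _ pq2 q2x.
  have := dD _ _ _ pq1 q1w; have := dD _ _ _ yq1 (conn_sym pq1).
  rewrite (dC q2 (h i)) (dC q1 (h i)) (dC y (h i)) (dC (h i) w) (dC (h i) x) (dC w y); lra.
exists (6 * D' + 2) => x y z w xy xz xw.
have wx := conn_sym xw; have wy := conn_trans wx xy; have wz := conn_trans wx xz.
(* The distance from [w] to any point of a side is at least the Gromov product of its ends, and [p]
   nearly attains it for [x] and [y]. As [p] is close to a point [q] of another side, the product of
   [x] and [y] is nearly at least that of the ends of this side. *)
have [p bp hp] := insize w x y wx wy.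
have [q [pq dq bq]] := thinV x y z p xz bp.
have wp : conn w p by case: bp => xp _ _; exact: conn_trans wx xp.
have wq := conn_trans wp pq.
have := dD _ _ _ wp pq.
case: bq => [[yq qz e]|[zq qx e]].
  have E : d y z = d y q + d q z by rewrite /d e natrD.
  have := dD _ _ _ wq (conn_sym yq); have := dD _ _ _ wq qz.
  rewrite (dC q y) => h1 h2 h3; right.
  rewrite (dC z w) (dC x w); lra.
have E : d z x = d z q + d q x by rewrite /d e natrD.
have := dD _ _ _ wq (conn_sym zq); have := dD _ _ _ wq qx.
rewrite (dC q z) => h1 h2 h3; left.
rewrite (dC z w) (dC x z) (dC y w); lra.
Qed.

(** For [p] between [x1] and [x2], the condition on [p], [x1], [x2], [x3] makes the Gromov product
    at [p] of the ends of another side small; the branch point on that side is then close to [p]. *)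
Lemma four_point_side (delta : R) (x1 x2 x3 : gpoint R G) S1 S2 S3 :
  four_point (@rconn R G) (@rd R G) delta ->
  rconn x1 x2 -> rconn x1 x3 ->
  geodesic x1 x2 S1 -> geodesic x2 x3 S2 -> geodesic x3 x1 S3 ->
  S1 `<=` neighborhood (2 * delta) (S2 `|` S3).
Proof.
move=> fp c12 c13 g1 g2 g3 p S1p.
have [_ c1p e1] := geodesic_mem g1 S1p.
have cp1 := rconn_sym c1p; have cp2 := rconn_trans cp1 c12; have cp3 := rconn_trans cp1 c13.
have close a b S : rconn p a -> rconn p b -> geodesic a b S ->
    rd p a + rd p b - rd a b <= delta ->
    exists2 q, S q & (edist (p, q) <= (2 * delta)%:E)%E.
  move=> pa pb gS small.
  have ab := rconn_trans (rconn_sym pa) pb.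
  have [|q Sq [aq qb]] := geodesic_point (s := (rd p a + rd a b - rd p b) / 2) gS.
    have := rdD pa ab; have := rdD pb (rconn_sym ab); rewrite (rdC b a) => h1 h2.
    by apply/andP; split; lra.
  exists q => //; have [_ caq _] := geodesic_mem gS Sq.
  have pq := rconn_trans pa caq; rewrite rdE // lee_fin.
  have d0 : 0 <= delta.
    by have := fp _ _ _ _ (rconn_refl p) (rconn_refl p) (rconn_refl p); rewrite !rd0; case; lra.
  by have := fp _ _ _ _ pq pa pb; rewrite (rdC q a); case; lra.
have inf q : (S2 `|` S3) q -> (edist (p, q) <= (2 * delta)%:E)%E ->
    neighborhood (2 * delta) (S2 `|` S3) p.
  by move=> Sq le; apply: le_trans le; apply: ereal_inf_lbound; exists q.
have [h|h] := fp _ _ _ _ cp3 cp1 cp2.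
  have [|q Sq dq] := close x2 x3 S2 cp2 cp3 g2.
    by rewrite (rdC x2 x3); rewrite (rdC x1 p) in e1; lra.
  by apply: inf dq; left.
have [|q Sq dq] := close x3 x1 S3 cp3 cp1 g3.
  by rewrite (rdC x1 p) in e1; lra.
by apply: inf dq; right.
Qed.

Lemma four_point_thin (delta : R) :
  four_point (@conn G) d delta -> thin_triangles (2 * (delta + 8)).
Proof.
move=> /four_point_realization fp x1 x2 x3 S1 S2 S3 c12 c13 g1 g2 g3.
have c21 := rconn_sym c12; have c31 := rconn_sym c13.
split; first exact: (four_point_side fp c12 c13 g1 g2 g3).
  exact: (four_point_side fp (rconn_trans c21 c13) c21 g2 g3 g1).
exact: (four_point_side fp c31 (rconn_trans c31 c12) g3 g1 g2).
Qed.

Lemma hyperbolicP : hyperbolic (gpoint R G) <->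
  exists delta, four_point (@conn G) d delta.
Proof.
split=> [/hyperbolic_thin[D /thin_four_point //]|[delta fp]].
apply: (@thin_hyperbolic (2 * (`|delta| + 8))); first by have := normr_ge0 delta; lra.
apply: four_point_thin => x y z t xy xz xt; have := ler_norm delta.
by have [h|h] := fp _ _ _ _ xy xz xt; [left|right]; lra.
Qed.

End Hyperbolicity.

(** * Quasi-convexity of the set of centers *)

Lemma natr_bounded (R : realType) (T : Type) (f : T -> nat) (b : \bar R) :
  (b < +oo)%E -> (forall t, ((f t)%:R%:E <= b)%E) -> exists K : nat, forall t, (f t <= K)%N.
Proof.
move=> bfin fb; exists (Num.truncn (fine b)) => t.
case: b bfin fb => [r _||_] // fb; last by have := fb t; rewrite leeNy_eq.
have := fb t; rewrite lee_fin => h.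
by rewrite truncn_ge_nat //; apply: le_trans h; exact: ler0n.
Qed.

Section Cycles.
Variables (R : realType) (G : sgraph).

(** A path from [u] to a point of the cycle enters its edge through an end with positive coordinate,
    which is a vertex of the cycle. *)
Lemma cycle_points_ball (C : seq G) (u : G) (k : nat) :
  cycle_points R C `&` ball (vpoint R u) k%:R !=set0 ->
  exists2 v, v \in C & exists2 n, walk n u v & (n <= k)%N.
Proof.
move=> [x [[a aC [t /andP[t0 t1] xE]] /gballP[l /bpath_from_vertex[v [n [uv xv le]]] lk]]].
exists v.
  have [->|->] // : v = a \/ v = next C a.
    by apply: (@bary_edge_supp R G a (next C a) t); rewrite -xE gt_eqF.
  by rewrite mem_next.
exists n => //; rewrite -(ler_nat R).
suff : x v <= 1 by lra.
rewrite xE /bary_edge /bary_vertex.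
by case: (v == a); case: (v == next C a); rewrite /= ?mulr1 ?mulr0; lra.
Qed.

Lemma cycle_walk (C : seq G) v : is_cycle C -> v \in C -> walk (size C) v v.
Proof.
move=> [_ /andP[cC _]] /rot_to[i p pE].
move: cC; rewrite -(rot_cycle i) pE /= => /walk_path.
by rewrite last_rcons size_rcons -(size_rot i C) pE.
Qed.

End Cycles.

Section QuasiGeodesics.
Variables (R : realType) (G : sgraph) (J : Type) (w : J -> G).
Hypothesis connG : connected_graph G.

Let vp (v : G) : gpoint R G := vpoint R v.
Let d (u v : G) : R := (gd u v)%:R.
Let W := [set vp (w j) | j in [set: J]].

Let cn u v : conn u v := connected_conn connG u v.

Let rconnT (x y : gpoint R G) : rconn x y.
Proof.
apply: rconn_trans (rconn_nv x) _; apply: rconn_trans (rconn_sym (rconn_nv y)).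
exact: (rd_vertex R (cn _ _)).1.
Qed.

Lemma hyperbolic_connectedP : hyperbolic (gpoint R G) <->
  exists delta, four_point (fun _ _ => True) d delta.
Proof.
rewrite hyperbolicP; split=> -[delta fp]; exists delta => x y z t *; apply: fp => //;
  exact: cn.
Qed.

(** Gromov products vanish along a geodesic, so its vertices are within [c / 2] of a center; one
    more unit reaches all its points. *)
Lemma quasi_convex_geodesic (c : R) k l : quasi_convex d w c ->
  exists2 S, geodesic (vp (w k)) (vp (w l)) S &
    forall x, S x -> (edist_inf W x <= (1 + c / 2)%:E)%E.
Proof.
move=> qc.
have [S [gS _ Sn]] := between_geodesic R (between_refl (cn (w k) (w l))).
exists S => // x /Sn[q [_ _ e] [cxq xq]].
have [m hm] := qc q k l.
have E : d (w k) (w l) = d q (w k) + d q (w l).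
  by rewrite /d -natrD e (gdC q (w k)).
apply: (@le_trans _ _ (edist (x, vp (w m)))).
  by apply: ereal_inf_lbound; exists (vp (w m)) => //; exists m.
rewrite rdE // lee_fin; apply: le_trans (rdD cxq (rconnT _ _)) _.
have [_ ->] := rd_vertex R (cn q (w m)); rewrite -/(d q (w m)); lra.
Qed.

Lemma geodesic_quasi_geodesic (x y : gpoint R G) S : geodesic x y S ->
  exists a b f, quasi_geodesic 1 0 x y a b f /\ forall t, t \in `[a, b] -> S (f t).
Proof.
move=> [L [g [L0 g0 gL iso ->]]]; exists 0, L, g; split; last by move=> t tL; exists t.
split => // s t sL tL; rewrite iso // invr1 mul1r subr0 addr0.
by split; exact: lexx.
Qed.

(** * Sampling a quasi-geodesic at unit times *)

Section Chain.
Variables (alpha beta a b : R) (x y : gpoint R G) (f : R -> gpoint R G).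
Hypothesis alpha1 : 1 <= alpha.
Hypothesis beta0 : 0 <= beta.
Hypothesis qg : quasi_geodesic alpha beta x y a b f.

Definition chain_time (i : nat) : R := Num.min (a + i%:R) b.
Definition chain (i : nat) : G := nv (f (chain_time i)).
(** The successor ensures that the last sample is taken at [b]. The last step may be shorter than
    one, even zero, which explains the loss of [1] in [chain_time_gap]. *)
Definition chain_size : nat := (Num.truncn (b - a)).+1.

Let ab : a <= b. Proof. by case: qg. Qed.

Let size_bounds : a + chain_size%:R - 1 <= b /\ b <= a + chain_size%:R.
Proof.
have ba : 0 <= b - a by rewrite subr_ge0.
have /andP[] := truncn_itv ba; rewrite /chain_size -natr1; lra.
Qed.

Lemma chain_time_in i : chain_time i \in `[a, b].
Proof.
by rewrite in_itv /= /chain_time le_min ge_min lexx orbT ab lerDl ler0n.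
Qed.

Lemma chain_time0 : chain_time 0 = a.
Proof. by rewrite /chain_time addr0 (min_l ab). Qed.

Lemma chain_time_size : chain_time chain_size = b.
Proof. by rewrite /chain_time min_r //; have [] := size_bounds. Qed.

Lemma chain_time_step i : `|chain_time i - chain_time i.+1| <= 1.
Proof.
rewrite /chain_time -natr1 ler_norml.
by case: (leP (a + i%:R) b) => h; case: (leP (a + (i%:R + 1)) b) => h'; apply/andP; split; lra.
Qed.

Lemma chain_time_gap i j : (i <= j <= chain_size)%N ->
  (j - i)%:R - 1 <= `|chain_time i - chain_time j|.
Proof.
move=> /andP[ij jN]; have [s1 s2] := size_bounds.
have : i%:R <= j%:R :> R by rewrite ler_nat.
have : j%:R <= chain_size%:R :> R by rewrite ler_nat.
rewrite natrB // => h1 h2; rewrite distrC; apply: le_trans (ler_norm _).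
rewrite /chain_time; case: (leP (a + i%:R) b) => h; case: (leP (a + j%:R) b) => h'; lra.
Qed.

Lemma chain_step i : d (chain i) (chain i.+1) <= alpha + beta + 2.
Proof.
have [_ _ _ qgi] := qg.
have [_ ub] := qgi _ _ (chain_time_in i) (chain_time_in i.+1).
have [c rle] := rconn_le ub; have [le _] := gd_nv c.
apply: le_trans le _; rewrite lerD2r; apply: le_trans rle _; rewrite lerD2r.
by apply: ler_piMr; [exact: le_trans ler01 alpha1|exact: chain_time_step].
Qed.

(** The computation gives slope [alpha] and intercept [alpha * (2 + beta) + 1]; one larger constant
    serves for both, as [geodesic_near_chain] expects. *)
Lemma chain_gap i j : (i <= j <= chain_size)%N ->
  (j - i)%:R <= (alpha * (3 + beta) + 1) * d (chain i) (chain j) + (alpha * (3 + beta) + 1).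
Proof.
move=> /chain_time_gap gap; have [_ _ _ qgi] := qg.
have [lb _] := qgi _ _ (chain_time_in i) (chain_time_in j).
have [_] := gd_nv (rconnT (f (chain_time i)) (f (chain_time j))).
rewrite -/(chain i) -/(chain j) -/(d (chain i) (chain j)) => le.
move: lb; rewrite rdE // lee_fin => lb.
have a0 : 0 < alpha by exact: lt_le_trans ltr01 alpha1.
have {gap lb le} : alpha^-1 * ((j - i)%:R - 1) <= d (chain i) (chain j) + 2 + beta.
  apply: (@le_trans _ _ (alpha^-1 * `|chain_time i - chain_time j|)).
    by rewrite ler_wpM2l // invr_ge0 ltW.
  lra.
rewrite ler_pdivrMl // => h.
have d0 : 0 <= d (chain i) (chain j) by exact: ler0n.
have ab0 : 0 <= alpha * beta by rewrite mulr_ge0 // ltW.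
have : 0 <= (alpha * (2 + beta) + 1) * d (chain i) (chain j).
  by apply: mulr_ge0 => //; lra.
lra.
Qed.

End Chain.

Lemma quasi_geodesic_quasi_convex (c alpha beta : R) :
  1 <= alpha -> 0 <= beta ->
  (exists delta, four_point (fun _ _ => True) d delta) ->
  (forall k l, exists a b f,
     quasi_geodesic alpha beta (vp (w k)) (vp (w l)) a b f /\
     forall t, t \in `[a, b] -> (edist_inf W (f t) <= c%:E)%E) ->
  exists c', quasi_convex d w c'.
Proof.
move=> a1 b0 [delta fp] qgW.
have dm := pmetric_gd R connG.
have A0 : 0 <= alpha * (3 + beta) + 1 by rewrite addr_ge0 // mulr_ge0; lra.
have lam0 : 0 <= alpha + beta + 2 by lra.
have [C _ near] := geodesic_near_chain dm fp lam0 A0.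
exists (2 * delta + 2 * C + 2 * c + 20) => x k l.
have [a [b [f [qg fW]]]] := qgW k l.
pose N := chain_size a b; pose y := chain a b f.
have [h [h0 hn hadj]] := walk_geodesic (cn (y 0%N) (y N)).
set n := gd (y 0%N) (y N) in hn hadj.
have gdh : gd (h 0%N) (h n) = n by rewrite h0 hn.
have hd i j : (i <= j <= n)%N -> d (h i) (h j) = (j - i)%:R.
  by move=> ij; rewrite /d (gd_path hadj gdh ij).2.
have {}near := near y h N n (fun i _ => chain_step a1 qg i)
  (fun i j => @chain_gap _ _ _ _ _ _ _ a1 b0 qg i j) hd h0 hn.
have nE : d (y 0%N) (y N) = n%:R by [].
have yk : d (y 0%N) (w k) <= 1.
  have [_ fa _ _] := qg.
  have c0 := rconn_nv (vp (w k)); have := rd_nv (vp (w k)).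
  have [_ ->] := rd_vertex R (rconn_conn c0).
  by rewrite /y /chain (chain_time0 qg) fa /d gdC.
have yl : d (y N) (w l) <= 1.
  have [_ _ fb _] := qg.
  have c0 := rconn_nv (vp (w l)); have := rd_nv (vp (w l)).
  have [_ ->] := rd_vertex R (rconn_conn c0).
  by rewrite /y /chain (chain_time_size qg) fb /d gdC.
(* Position, on the geodesic from [y 0] to [y N], of the branch point of the tripod with third end
   [x]. The vertex [h i] just before it is within one unit, is close to the chain, and so is close
   to a center. *)
pose s := (d x (y 0%N) + d (y 0%N) (y N) - d x (y N)) / 2.
have s0 : 0 <= s by have := pmD dm x (y 0%N) (y N); rewrite /s -/(d _ _); lra.
have sn : s <= n%:R.
  have := pmD dm x (y N) (y 0%N); rewrite -nE /s (pmC dm (y N) (y 0%N)); lra.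
have /andP[si iS] := truncn_itv s0; set i := Num.truncn s in si iS.
have ni : (i <= n)%N by rewrite -(ler_nat R); exact: le_trans si sn.
have y0i : d (y 0%N) (h i) = i%:R by rewrite -h0 hd ?subn0.
have iyN : d (h i) (y N) = n%:R - i%:R by rewrite -hn hd ?ni ?leqnn // natrB.
have proj : 2 * d x (h i) <= d x (y 0%N) + d x (y N) - d (y 0%N) (y N) + 2 * (delta + 1).
  apply: (gromov_projection dm fp).
    by rewrite -/(d _ _) y0i; rewrite /s in si; lra.
  rewrite -/(d _ _) iyN -nE; move: iS; rewrite -natr1 /s; lra.
have [m mN hm] := near i ni.
have := fW _ (chain_time_in qg m) => /le_lt_trans.
move=> /(_ (c + 1)%:E); rewrite lte_fin ltrDl ltr01 => /(_ isT).
move=> /ereal_inf_lt[_ [_ [p _ <-] <-] /ltW /rconn_le[cp dp]].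
have yp : d (y m) (w p) <= c + 2.
  have [_ E] := rd_vertex R (cn (y m) (w p)); rewrite /d -E.
  apply: le_trans (rdD (rconn_sym (rconn_nv _)) cp) _.
  by rewrite rdC; have := rd_nv (f (chain_time a b m)); lra.
exists p.
have := pmD dm x (h i) (w p); have := pmD dm (h i) (y m) (w p).
have := pmD dm x (w k) (y 0%N); have := pmD dm x (w l) (y N).
have := pmD dm (w k) (y 0%N) (w l); have := pmD dm (y 0%N) (y N) (w l).
rewrite (pmC dm (w k) (y 0%N)) (pmC dm (w l) (y N)).
rewrite -!/(d _ _); lra.
Qed.

End QuasiGeodesics.

Theorem theorem2p37 (R : realType) (G1 G2 : sgraph) (J : Type)
    (w : J -> G1) (Kj : J -> nat) (K : \bar R) (M : R) :
  let B := fun j : J => ball (vpoint R (w j)) (Kj j)%:R in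
  let W := [set vpoint R (w j) | j in [set: J]] in
  connected_graph G1 ->
  (forall j, (0 < Kj j)%N) ->
  ereal_sup [set ((Kj j)%:R%:E : \bar R) | j in [set: J]] = K -> (K < +oo)%E ->
  (forall j1 j2, j1 <> j2 -> closure (B j1) `&` closure (B j2) = set0) ->
  (forall C : seq G1, odd_cycle C ->
     exists j, cycle_points R C `&` B j !=set0) ->
  0 < M ->
  (forall j, exists C : seq G1,
     [/\ odd_cycle C, cycle_points R C `&` B j !=set0 & (size C)%:R < M]) ->
  connected_graph G2 ->
  ~ trivial_graph G2 ->
  bounded_space (gpoint R G2) ->
  (forall C : seq G2, ~ odd_cycle C) ->
  [<-> hyperbolic (gpoint R (dprod G1 G2));
       hyperbolic (gpoint R G1) /\
         exists c1 : R, forall k l : J,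
           exists2 S : set (gpoint R G1),
             geodesic (vpoint R (w k)) (vpoint R (w l)) S &
             forall x, S x -> (edist_inf W x <= c1%:E)%E;
       hyperbolic (gpoint R G1) /\
         exists c2 alpha beta : R,
           [/\ 1 <= alpha, 0 <= beta &
             forall k l : J, exists (a b : R) (f : R -> gpoint R G1),
               quasi_geodesic alpha beta (vpoint R (w k)) (vpoint R (w l)) a b f /\
               forall t, t \in `[a, b] -> (edist_inf W (f t) <= c2%:E)%E]].
Proof.
move=> B W conn1 _ supK Kfin _ meetB M0 regB conn2 nt2 bounded2 bip2.
have [K0 KK0] : exists K0, forall j, (Kj j <= K0)%N.
  by apply: (natr_bounded Kfin) => j; rewrite -supK; apply: ereal_sup_ubound; exists j.
have [D2 diam2] : exists D2, forall a b : G2, (gd a b <= D2)%N.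
  have [D hD] : exists D, forall ab : G2 * G2, (gd ab.1 ab.2 <= D)%N.
    apply: (natr_bounded bounded2) => -[a b].
    have [c <-] := rd_vertex R (connected_conn conn2 a b).
    by rewrite -rdE //; apply: ereal_sup_ubound; exists (vpoint R a, vpoint R b).
  by exists D => a b; exact: (hD (a, b)).
have cycles C : odd_cycle C -> exists j, exists2 v, v \in C & (gd (w j) v <= K0)%N.
  move=> /meetB[j /cycle_points_ball[v vC [n jv nK]]]; exists j, v => //.
  exact: leq_trans (gd_le jv) (leq_trans nK (KK0 j)).
(* The loop goes from [w j] to the odd cycle, around it, and back along the same walk, so its parity
   is that of the cycle. *)
have loops j : exists n,
    [/\ odd n, (n <= 2 * K0 + Num.truncn M)%N & walk n (w j) (w j)].
  have [C [[cC oC] /cycle_points_ball[v vC [n jv nK]] CM]] := regB j.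
  exists (n + (size C + n))%N; split.
  - by rewrite addnCA oddD addnn odd_double addbF.
  - have : (size C <= Num.truncn M)%N by rewrite truncn_ge_nat ltW.
    by have := KK0 j; lia.
  - exact: walk_cat jv (walk_cat (cycle_walk cC vC) (walk_sym jv)).
have [kappa kappaP] := two_coloring bip2.
have [c cP] := far_coloring cycles.
tfae.
- move=> /hyperbolicP[delta fp].
  have [fp1 [c0 qc]] := dprod_four_point conn1 conn2 nt2 kappaP diam2 loops cP fp.
  split; first exact/hyperbolic_connectedP.
  by exists (1 + c0 / 2) => k l; exact: quasi_convex_geodesic.
- move=> [hyp [c1 geo]]; split => //; exists c1, 1, 0; split => // k l.
  have [S /geodesic_quasi_geodesic[a [b [f [qg fS]]]] SW] := geo k l.
  by exists a, b, f; split => // t /fS /SW.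
- move=> [/(hyperbolic_connectedP _ conn1) fp1 [c2 [alpha [beta [a1 b0 qg]]]]].
  have [c0 qc] := quasi_geodesic_quasi_convex conn1 a1 b0 fp1 qg.
  have [delta fp] := fp1.
  exact/hyperbolicP/(four_point_dprod conn1 conn2 nt2 kappaP diam2 loops cP fp qc).
Qed.
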